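(* Let $L=\{<,\ldots\}$ be a countable first order language containing a binary relation symbol $<$, and let $T$ be a complete $L$-theory with Skolem functions in which $<$ is interpreted as a linear order. Suppose $T$ satisfies the inaccessibility scheme. Let $\kappa$ be a regular cardinal and let $M$ be a $\kappa$-saturated model of $T$ with $cof(M)=\kappa$. Then for every regular cardinal $\lambda\leq\kappa$, $M$ has an elementary end extension $N$ such that $|N|=|M|$ and $cof(N)=\lambda$.
   Context: For a formula $\varphi(\bar{x},\bar{t})$ and tuples $\bar{y}_0,\bar{y}_1$ of the same length as $\bar{x}$, write $E_{\varphi}(\bar{y}_0,\bar{y}_1;z_0)$ for the formula $(\forall \bar{t}<z_0)(\varphi(\bar{y}_0,\bar{t})\leftrightarrow\varphi(\bar{y}_1,\bar{t}))$; here $\bar{t}<z_0$ means every coordinate of $\bar{t}$ is $<z_0$. $T$ satisfies the inaccessibility scheme if for every formula $\varphi(\bar{x},\bar{t})$ of $L$ (with $\bar{x}$ a tuple of any finite length), $T\models (\forall z_0)(\exists z_1>z_0)(\forall\bar{y}_0)(\exists\bar{y}_1<z_1)E_{\varphi}(\bar{y}_0,\bar{y}_1;z_0)$. ''$T$ has Skolem functions'' means that for every formula $\theta(y,\bar{x})$ there is a term $\tau(\bar{x})$ of $L$ with $T\models \forall\bar{x}(\exists y\,\theta(y,\bar{x})\to\theta(\tau(\bar{x}),\bar{x}))$. For a regular cardinal $\kappa$, $cof(M)=\kappa$ means $\kappa$ is the least cardinal such that there is a strictly increasing sequence of length $\kappa$ cofinal in $(M,<)$. $N$ is an elementary end extension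 of $M$ if $M\preceq N$ and every element of $N$ that is $<$ some element of $M$ belongs to $M$. $|M|$ denotes the cardinality of $M$. *)

(* Defs.v *)
From Stdlib Require List.
From mathcomp Require Import all_boot.
Set Implicit Arguments.
Unset Strict Implicit.
Unset Printing Implicit Defensive.

Record Lang := {
  Func : Type;
  fun_ar : Func -> nat;
  Rel : Type;
  rel_ar : Rel -> nat;
  lt_sym : Rel;
  lt_ar : rel_ar lt_sym = 2
}.

Definition countable_lang (L : Lang) : Prop :=
  (exists f : Func L -> nat, injective f) /\ (exists g : Rel L -> nat, injective g).

Inductive term (L : Lang) : Type :=
| tvar : nat -> term L
| tapp : forall f : Func L, ('I_(fun_ar f) -> term L) -> term L.

Inductive form (L : Lang) : Type :=
| fEq : term L -> term L -> form L
| fRel : forall R : Rel L, ('I_(rel_ar R) -> term L) -> form L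
| fFalse : form L
| fImp : form L -> form L -> form L
| fAll : form L -> form L.

Definition fNeg (L : Lang) (p : form L) : form L := fImp p (@fFalse L).

Fixpoint term_fv_lt (L : Lang) (k : nat) (t : term L) : Prop :=
  match t with
  | tvar i => (i < k)%N
  | tapp f args => forall i, term_fv_lt k (args i)
  end.

Fixpoint form_fv_lt (L : Lang) (k : nat) (p : form L) : Prop :=
  match p with
  | fEq t1 t2 => term_fv_lt k t1 /\ term_fv_lt k t2
  | fRel R args => forall i, term_fv_lt k (args i)
  | fFalse => True
  | fImp p1 p2 => form_fv_lt k p1 /\ form_fv_lt k p2
  | fAll p1 => form_fv_lt k.+1 p1
  end.

Definition sentence (L : Lang) (p : form L) : Prop := form_fv_lt 0 p.

Record Structure (L : Lang) := {
  car :> Type;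
  inh : car;
  fun_i : forall f : Func L, ('I_(fun_ar f) -> car) -> car;
  rel_i : forall R : Rel L, ('I_(rel_ar R) -> car) -> Prop
}.

Definition scons (A : Type) (a : A) (e : nat -> A) : nat -> A :=
  fun n => match n with 0 => a | S k => e k end.

Fixpoint eval (L : Lang) (A : Structure L) (e : nat -> A) (t : term L) : A :=
  match t with
  | tvar i => e i
  | tapp f args => fun_i (fun i => eval e (args i))
  end.

Fixpoint sat (L : Lang) (A : Structure L) (e : nat -> A) (p : form L) : Prop :=
  match p with
  | fEq t1 t2 => eval e t1 = eval e t2
  | fRel R args => rel_i (fun i => eval e (args i))
  | fFalse => False
  | fImp p1 p2 => sat e p1 -> sat e p2
  | fAll p1 => forall a : A, sat (scons a e) p1
  end.

Definition ltM (L : Lang) (A : Structure L) (a b : A) : Prop :=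
  rel_i (fun i : 'I_(rel_ar (lt_sym L)) => if val i == 0 then a else b).

Definition models (L : Lang) (A : Structure L) (p : form L) : Prop :=
  forall e : nat -> A, sat e p.

Definition theory (L : Lang) := form L -> Prop.

Definition is_model (L : Lang) (T : theory L) (A : Structure L) : Prop :=
  forall p, T p -> models A p.

Definition entails (L : Lang) (T : theory L) (p : form L) : Prop :=
  forall A : Structure L, is_model T A -> models A p.

Definition complete_theory (L : Lang) (T : theory L) : Prop :=
  (forall p, T p -> sentence p) /\
  (exists A : Structure L, is_model T A) /\
  (forall p, sentence p -> entails T p \/ entails T (fNeg p)).

Definition lt_linear_in (L : Lang) (T : theory L) : Prop :=
  forall A : Structure L, is_model T A ->
    (forall a : A, ~ ltM a a) /\
    (forall a b c : A, ltM a b -> ltM b c -> ltM a c) /\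
    (forall a b : A, ltM a b \/ a = b \/ ltM b a).

(* Skolem functions: for every theta(y, xbar) (y = variable 0, xbar =
   the remaining variables) there is a term tau(xbar) with
   T |= forall xbar (exists y theta(y,xbar) -> theta(tau(xbar), xbar)).
   The term tau is written in the variables xbar (index k of tau is
   variable k+1 of theta). *)
Definition has_skolem_functions (L : Lang) (T : theory L) : Prop :=
  forall theta : form L, exists tau : term L,
    forall A : Structure L, is_model T A -> forall e : nat -> A,
      (exists a : A, sat (scons a e) theta) -> sat (scons (eval e tau) e) theta.

Definition tup_env (A : Type) (n : nat) (y t : nat -> A) : nat -> A :=
  fun i => if (i < n)%N then y i else t (i - n).

Definition inaccessibility_scheme (L : Lang) (T : theory L) : Prop :=
  forall (n m : nat) (phi : form L), form_fv_lt (n + m) phi ->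
    forall A : Structure L, is_model T A ->
      forall z0 : A, exists z1 : A, ltM z0 z1 /\
        forall y0 : nat -> A, exists y1 : nat -> A,
          (forall i, (i < n)%N -> ltM (y1 i) z1) /\
          forall t : nat -> A, (forall j, (j < m)%N -> ltM (t j) z0) ->
            (sat (tup_env n y0 t) phi <-> sat (tup_env n y1 t) phi).

Definition card_le (A B : Type) : Prop := exists f : A -> B, injective f.
Definition equinumerous (A B : Type) : Prop := exists f : A -> B, bijective f.
Definition card_lt (A B : Type) : Prop := card_le A B /\ ~ card_le B A.

Record WellOrder := {
  wo_car :> Type;
  wo_lt : wo_car -> wo_car -> Prop;
  wo_wf : well_founded wo_lt;
  wo_trans : forall a b c, wo_lt a b -> wo_lt b c -> wo_lt a c;
  wo_total : forall a b, wo_lt a b \/ a = b \/ wo_lt b a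
}.

(* A cardinal = an initial ordinal: a well order not equinumerous with
   any of its proper initial segments. *)
Definition is_cardinal (K : WellOrder) : Prop :=
  forall x : K, ~ equinumerous K {y : K | wo_lt y x}.

Definition infinite_type (A : Type) : Prop := card_le nat A.

Definition regular_cardinal (K : WellOrder) : Prop :=
  is_cardinal K /\ infinite_type K /\
  forall S : K -> Prop, (forall x : K, exists y, S y /\ ~ wo_lt y x) ->
    equinumerous {y : K | S y} K.

Definition cofinal_seq (L : Lang) (M : Structure L) (K : WellOrder) (f : K -> M) : Prop :=
  (forall i j : K, wo_lt i j -> ltM (f i) (f j)) /\
  (forall m : M, exists i : K, ~ ltM (f i) m).

Definition cof_eq (L : Lang) (M : Structure L) (K : WellOrder) : Prop :=
  (exists f : K -> M, cofinal_seq f) /\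
  forall K' : WellOrder, is_cardinal K' -> card_lt K' K ->
    ~ exists g : K' -> M, cofinal_seq g.

(* A (partial) 1-type over a parameter set P ⊆ M: a set of formulas
   phi(x, abar) given as pairs (phi, e), where variable 0 is x and the
   environment e assigns parameters from P to the remaining variables. *)
Definition kappa_saturated (L : Lang) (K : WellOrder) (M : Structure L) : Prop :=
  forall (P : M -> Prop), card_lt {a : M | P a} K ->
  forall (p : form L * (nat -> M) -> Prop),
    (forall q, p q -> forall i, P (q.2 i)) ->
    (forall l : seq (form L * (nat -> M)),
        (forall q, List.In q l -> p q) ->
        exists a : M, forall q, List.In q l -> sat (scons a q.2) q.1) ->
    exists a : M, forall q, p q -> sat (scons a q.2) q.1.

Definition elementary_embedding (L : Lang) (M N : Structure L) (h : M -> N) : Prop :=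
  forall (p : form L) (e : nat -> M), sat e p <-> sat (fun i => h (e i)) p.

Definition elem_end_ext (L : Lang) (M N : Structure L) (h : M -> N) : Prop :=
  elementary_embedding h /\
  forall (b : N) (a : M), ltM b (h a) -> exists a' : M, h a' = b.

(* Main.v *)
Require Import Defs.
From mathcomp Require Import all_boot.
From mathcomp Require Import boolp.
From mathcomp Require classical_sets.
Set Implicit Arguments.
Unset Strict Implicit.
Unset Printing Implicit Defensive.

(** If [card_le K Lam], take [N = M].  Otherwise [Lam < K].  Fix a cofinal
    sequence [m_i] ([i < K]) of [M] and build by recursion on [i] sequences
    [c^i] of length [Lam] in [M] such that [c^i] and [c^j] have the same type
    over the initial segment up to [m_j] whenever [j < i].  To keep the
    recursion going, the type of [c^i] over the segment up to [m_i] has to be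
    large: each finite fragment of it is satisfied by
    "unboundedly many x_1, for unboundedly many x_2, ...".  The inaccessibility
    scheme bounds representatives of all types over a segment and yields a
    regularity principle for definable partitions, hence some extension of a
    large type to a longer segment is large; at stage [i] only
    [|i| * Lam < K] parameters occur, so saturation applies.
    The types of the [c^i] converge to a type over [M] of a [Lam]-sequence [c].
    The model [N] is the Skolem hull of [M] and [c], realized as functions
    [i |-> t(a, c^i)] modulo eventual equality.  If [t(a, c) < b] with
    [a, b <= m_i], then [d = t(a, c^i)] is itself at most [m_i], so that
    [t(a, c) = d]: this makes [N] an end extension.  Largeness makes each
    [c_beta] exceed every [t(a, c_alpha, ...)] with indices below [beta], hence
    [c] is cofinal in [N]. *)

(** * Cardinals *)

(** Choice with default [a0]. The value depends on the predicate alone, so equal predicates receive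
    equal choices; this serves both for recursion and for picking representatives of classes. *)
Definition some_such (A : Type) (a0 : A) (P : A -> Prop) : A :=
  if pselect (exists a, P a) is left h then projT1 (cid h) else a0.

Lemma some_suchP (A : Type) (a0 : A) (P : A -> Prop) :
  (exists a, P a) -> P (some_such a0 P).
Proof. by rewrite /some_such; case: pselect => // h _; case: (cid h). Qed.

Lemma card_le_trans (A B C : Type) : card_le A B -> card_le B C -> card_le A C.
Proof. by move=> [f fi] [g gi]; exists (g \o f); apply: inj_comp. Qed.

Lemma card_le_refl (A : Type) : card_le A A.
Proof. by exists id. Qed.

Lemma card_le_prod (A B C D : Type) :
  card_le A B -> card_le C D -> card_le (A * C) (B * D).
Proof.
move=> [f fi] [g gi]; exists (fun p => (f p.1, g p.2)).
by move=> [a c] [a' c'] /= [/fi -> /gi ->].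
Qed.

Lemma card_le_sum (A B C D : Type) :
  card_le A B -> card_le C D -> card_le (A + C) (B + D).
Proof.
move=> [f fi] [g gi].
exists (fun p => match p with inl a => inl (f a) | inr c => inr (g c) end).
by move=> [a|c] [a'|c'] //= [] => [/fi ->|/gi ->].
Qed.

Lemma Cantor_Bernstein (A B : Type) :
  card_le A B -> card_le B A -> equinumerous A B.
Proof.
move=> [f fi] [g gi].
(* [C n] holds at the points reached after [n] rounds of [g \o f] from outside the range of [g]. The
   bijection is [f] on the union of these sets and the inverse of [g] elsewhere. *)
pose C := fix C n a := if n is m.+1 then exists2 a', C m a' & g (f a') = a
                       else forall b, g b <> a.
pose CC a := exists n, C n a.
have gE a : ~ CC a -> exists b, g b = a.
  by move=> nC; apply: contrapT => h; apply: nC; exists 0 => b e; apply: h; exists b.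
pose h a := if pselect (CC a) is right nC then projT1 (cid (gE a nC)) else f a.
have hC a : CC a -> h a = f a by rewrite /h; case: pselect.
have hN a : ~ CC a -> g (h a) = a.
  by rewrite /h; case: pselect => // nC _; case: cid.
have inC a : CC a -> CC (g (f a)) by move=> [n Cn]; exists n.+1, a.
have hi : injective h.
  move=> a a' e.
  have [Ca|nCa] := pselect (CC a); have [Ca'|nCa'] := pselect (CC a').
  - by apply: fi; rewrite -(hC a) // -(hC a').
  - by case: (nCa'); rewrite -(hN a') // -e (hC a) //; apply: inC.
  - by case: (nCa); rewrite -(hN a) // e (hC a') //; apply: inC.
  - by rewrite -(hN a) // e (hN a').
have hs b : exists a, h a = b.
  have [[[|n] /= Cn]|nC] := pselect (CC (g b)).
  - by case: (Cn b).
  - case: Cn => a Ca /gi e; exists a.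
    by rewrite hC //; exists n.
  - by exists (g b); apply: gi; rewrite hN.
exists h; have [k kP] := choice hs; exists k => // a.
exact/hi/kP.
Qed.

Lemma chain_bigcup (T : Type) (P : (T -> Prop) -> Prop) :
  (forall F : (T -> Prop) -> Prop, (forall X, F X -> P X) ->
     (forall X Y, F X -> F Y ->
        (forall t, X t -> Y t) \/ (forall t, Y t -> X t)) ->
     P (fun t => exists2 X, F X & X t)) ->
  exists2 X, P X & forall Y, P Y -> (forall t, X t -> Y t) ->
    forall t, Y t -> X t.
Proof.
move=> h; have [F FP tot|X [PX mX]] := @classical_sets.Zorn_bigcup T P.
  exact: h.
exists X => // Y PY XY t Yt; apply: contrapT => nX.
by apply: (mX Y) => //; split => // YX; apply: nX; apply: YX.
Qed.

(** Zorn's lemma on graphs of partial injections: a maximal one is total on [A] or onto [B], since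
    otherwise a new pair could be added. *)
Lemma card_le_total (A B : Type) : card_le A B \/ card_le B A.
Proof.
pose P (G : A * B -> Prop) := forall p q, G p -> G q -> (p.1 = q.1 <-> p.2 = q.2).
have [F FP tot|G PG mG] := @chain_bigcup _ P.
  move=> p q [X FX Xp] [Y FY Yq].
  by case: (tot X Y FX FY) => s; [apply: (FP Y)|apply: (FP X)] => //; apply: s.
have [hA|/existsNP[a na]] := pselect (forall a, exists b, G (a, b)).
  left; have [f fP] := choice hA; exists f => a a' e.
  exact: (PG _ _ (fP a) (fP a')).2.
have [hB|/existsNP[b nb]] := pselect (forall b, exists a, G (a, b)).
  right; have [f fP] := choice hB; exists f => b b' e.
  exact: (PG _ _ (fP b) (fP b')).1.
case: (na); exists b; apply: (mG (fun p => G p \/ p = (a, b))); last by right.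
  move=> [a1 b1] [a2 b2] [G1|[-> ->]] [G2|[-> ->]] //=.
  - exact: (PG _ _ G1 G2).
  - by split=> e; [case: na; exists b1; rewrite -e|case: nb; exists a1; rewrite -e].
  - by split=> e; [case: na; exists b2; rewrite e|case: nb; exists a2; rewrite e].
by move=> t; left.
Qed.

(** * Squares of infinite sets *)

Section Hessenberg.
Variable A : Type.
Implicit Types (G : (A * A) * A -> Prop).

Let D G a := exists c, G ((a, a), c).

(** The graphs of injections of D x D into D, where D is the domain [D G]. *)
Let Good G :=
  [/\ forall a b c a' b' c', G ((a, b), c) -> G ((a', b'), c') ->
        (c = c' <-> a = a' /\ b = b'),
      forall a b c, G ((a, b), c) -> [/\ D G a, D G b & D G c]
    & forall a b, D G a -> D G b -> exists c, G ((a, b), c)].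

(** Zorn's lemma, started at the pairing function of the naturals transported along [u]. The range
    of [u] thereby stays in the domain and can supply tags. *)
Lemma square_closed (u : nat -> A) : injective u ->
  exists2 G, Good G /\ (forall n, D G (u n)) &
    forall G', Good G' -> (forall t, G t -> G' t) -> forall t, G' t -> G t.
Proof.
move=> ui; pose pr (m n : nat) := u (pickle (m, n)).
have pri m n m' n' : pr m n = pr m' n' <-> m = m' /\ n = n'.
  split=> [/ui/(pcan_inj (@pickleK _)) [-> ->]//|[-> ->]//].
pose G0 (t : (A * A) * A) := exists m n, t = ((u m, u n), pr m n).
have DG0 n : D G0 (u n) by exists (pr n n), n, n.
have gG0 : Good G0.
  split.
  - move=> a b c a' b' c' [m [n [-> -> ->]]] [m' [n' [-> -> ->]]].
    rewrite pri; split=> [[-> ->]//|[/ui -> /ui ->]//].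
  - by move=> a b c [m [n [-> -> ->]]]; split; apply: DG0.
  - by move=> a b [c [m [_ [-> _ _]]]] [d [n [_ [-> _ _]]]]; exists (pr m n), m, n.
pose P G := (forall t, ~ G t) \/ (Good G /\ forall t, G0 t -> G t).
have [F FP tot|G PG mG] := @chain_bigcup _ P.
  have [[X0 FX0 [gX0 s0]]|nF] :=
    pselect (exists2 X, F X & Good X /\ forall t, G0 t -> X t); last first.
    left=> t [X FX Xt]; case: (FP X FX) => [/(_ t)//|gX].
    by apply: nF; exists X.
  have gF X t : F X -> X t -> Good X by move=> FX Xt; case: (FP X FX) => [/(_ t)|[]].
  have two X Y : F X -> F Y -> exists2 Z, F Z &
      (forall t, X t -> Z t) /\ (forall t, Y t -> Z t).
    by move=> FX FY; case: (tot X Y FX FY) => s; [exists Y|exists X].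
  right; split; last by move=> t /s0 X0t; exists X0.
  split.
  - move=> a b c a' b' c' [X FX Xt] [Y FY Yt].
    have [Z FZ [sX sY]] := two X Y FX FY.
    have [h _ _] := gF Z _ FZ (sX _ Xt); exact: h (sX _ Xt) (sY _ Yt).
  - move=> a b c [X FX Xt]; have [_ h _] := gF X _ FX Xt.
    by have [[x ?] [y ?] [z ?]] := h _ _ _ Xt; split; [exists x|exists y|exists z]; exists X.
  - move=> a b [c [X FX Xt]] [d [Y FY Yt]].
    have [Z FZ [sX sY]] := two X Y FX FY.
    have [_ _ h] := gF Z _ FZ (sX _ Xt).
    have [||e Ze] := h a b; [by exists c; apply: sX|by exists d; apply: sY|].
    by exists e, Z.
have [gG sG] : Good G /\ forall t, G0 t -> G t.
  case: PG => // nG; case: (nG ((u 0, u 0), pr 0 0)).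
  by apply: (mG G0); [right|move=> t /nG|exists 0, 0].
exists G; first by split=> // n; have [c /sG] := DG0 n; exists c.
by move=> G' gG' s; apply: mG => //; right; split=> // t /sG /s.
Qed.

(** Take a maximal X with an injection of X x X into X. If the complement of X is no larger than X,
    then [A] embeds in X and the injection transfers to [A]. Otherwise the complement contains a
    copy of X, and the injection extends to X together with this copy, against maximality. *)
Theorem Hessenberg : infinite_type A -> card_le (A * A) A.
Proof.
move=> [u ui]; have [G [[Gi GD Gt] Du] mG] := square_closed ui.
pose X := D G.
have [f fP] : exists f : A -> A -> A, forall a b, X a -> X b -> G ((a, b), f a b).
  have h p : exists c, X p.1 -> X p.2 -> G (p, c).
    case: p => a b /=; have [[Xa Xb]|n] := pselect (X a /\ X b).
      by have [c] := Gt _ _ Xa Xb; exists c.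
    by exists a => Xa Xb; case: n.
  by have [f fP] := choice h; exists (fun a b => f (a, b)) => a b; apply: (fP (a, b)).
have fX a b : X a -> X b -> X (f a b).
  by move=> Xa Xb; have [] := GD _ _ _ (fP a b Xa Xb).
have fi a b a' b' : X a -> X b -> X a' -> X b' -> f a b = f a' b' -> a = a' /\ b = b'.
  by move=> Xa Xb Xa' Xb'; apply: (Gi _ _ _ _ _ _ (fP _ _ Xa Xb) (fP _ _ Xa' Xb')).1.
have uE m n : u m = u n -> m = n by apply: ui.
have Xu n : X (u n) := Du n.
case: (card_le_total {a | X a} {a | ~ X a}) => [[g gi]|[g gi]]; last first.
  have Xg p : X (sval (g p)) by case: (g p).
  (* The tags [u 0] and [u 1] keep the images of X and of its complement apart. *)
  pose j a := if pselect (X a) is right nX then f (u 1) (sval (g (exist _ a nX)))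
              else f (u 0) a.
  have jX a : X (j a).
    by rewrite /j; case: pselect => Xa; apply: fX => //; case: (g _).
  have ji : injective j.
    move=> a b; rewrite /j; case: pselect => Xa; case: pselect => Xb.
    - by case/fi; auto.
    - by case/fi; auto; move/uE.
    - by case/fi; auto; move/uE.
    - case/fi; auto=> _ e.
      suff /gi : g (exist _ a Xa) = g (exist _ b Xb) by case.
      case: (g (exist _ a Xa)) (g (exist _ b Xb)) e => x nx [y ny] /= e.
      by case: _ / e ny => ny; congr exist; apply: Prop_irrelevance.
  exists (fun p => f (j p.1) (j p.2)) => -[a b] [a' b'] /=.
  by case/fi => //; try exact: jX; move=> /ji -> /ji ->.
exfalso.
have X0 := Du 0; rewrite -/X in X0.
pose g' a := if pselect (X a) is left Xa then sval (g (exist _ a Xa)) else a.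
have g'N a : X a -> ~ X (g' a).
  by move=> Xa; rewrite /g'; case: pselect => // Xa'; case: (g _).
have g'i a b : X a -> X b -> g' a = g' b -> a = b.
  move=> Xa Xb; rewrite /g'; case: pselect => // Xa'; case: pselect => // Xb' e.
  suff /gi : g (exist _ a Xa') = g (exist _ b Xb') by case.
  case: (g (exist _ a Xa')) (g (exist _ b Xb')) e => x nx [y ny] /= e.
  by case: _ / e ny => ny; congr exist; apply: Prop_irrelevance.
pose Z a := X a \/ exists2 x, X x & g' x = a.
have [pi [piX pi1 pi2]] : exists pi : A -> A,
    [/\ forall a, Z a -> X (pi a), forall a, X a -> pi a = a
      & forall a, Z a -> ~ X a -> g' (pi a) = a].
  have h a : exists b, Z a -> X b /\ (X a -> b = a) /\ (~ X a -> g' b = a).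
    have [Xa|nX] := pselect (X a); first by exists a.
    have [[x Xx e]|n] := pselect (exists2 x, X x & g' x = a); first by exists x.
    by exists a => -[].
  have [pi piP] := choice h; exists pi; split=> a.
  - by move=> /piP [].
  - by move=> Xa; have [_ [h1 _]] := piP a (or_introl Xa); apply: h1.
  - by move=> /piP [_ []].
(* The tag records which coordinates lie in X, information that [pi] forgets. Three values are
   enough, since the new part of [G'] contains only pairs outside X x X. *)
pose tag a b : A := if pselect (X a) then u 0 else if pselect (X b) then u 1 else u 2.
have tagX a b : X (tag a b).
  by rewrite /tag; case: pselect => [?|?]; first exact: Du; case: pselect => ?; exact: Du.
pose F a b := g' (f (tag a b) (f (pi a) (pi b))).
have FX a b : Z a -> Z b -> X (f (tag a b) (f (pi a) (pi b))).
  by move=> Za Zb; do 2!apply: (fX) => //; apply: piX.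
have Fi a b a' b' : Z a -> Z b -> Z a' -> Z b' -> ~ (X a /\ X b) ->
    ~ (X a' /\ X b') -> F a b = F a' b' -> a = a' /\ b = b'.
  move=> Za Zb Za' Zb' n n' /g'i h; have {h} := h (FX _ _ Za Zb) (FX _ _ Za' Zb').
  have pa := piX _ Za; have pb := piX _ Zb; have pa' := piX _ Za'; have pb' := piX _ Zb'.
  case/fi; try (exact: tagX); try (by apply: (fX)).
  move=> et /fi; case=> // ea eb.
  have same x y : Z x -> Z y -> pi x = pi y -> (X x <-> X y) -> x = y.
    move=> Zx Zy e [xy yx]; have [Xx|nX] := pselect (X x).
      by rewrite -(pi1 x) // e pi1 //; apply: xy.
    by rewrite -(pi2 x) // e pi2 // => /yx.
  suff [ha hb] : (X a <-> X a') /\ (X b <-> X b') by split; apply: same.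
  move: et; rewrite /tag.
  by case: pselect => xa; case: pselect => xa'; try case: pselect => xb;
    try case: pselect => xb'; move/uE => //; tauto.
pose G' t := G t \/ exists a b, [/\ Z a, Z b, ~ (X a /\ X b) & t = ((a, b), F a b)].
have GX a b c : G ((a, b), c) -> X a /\ X b by move=> /GD [].
have DG' a : D G' a <-> Z a.
  split=> [[c [Ga|[x [y [Zx _ _ [-> _ _]]]]]]//|Za].
    by left; exists c.
  have [[c Gc]|nX] := pselect (X a); first by exists c; left.
  by exists (F a a); right; exists a, a; split => // -[].
have ZF a b : Z a -> Z b -> Z (F a b) by move=> Za Zb; right; eexists; first exact: FX Za Zb.
(* Maximality puts [g' (u 0)], which lies in the domain of [G'], into X; but [g'] avoids X. *)
apply: (g'N (u 0)) => //; exists (F (g' (u 0)) (g' (u 0))).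
have Zg : Z (g' (u 0)) by right; exists (u 0).
apply: (mG G'); last by right; exists (g' (u 0)), (g' (u 0)); split=> // -[h _]; exact: (g'N _ _ h).
- split.
  + move=> a b c a' b' c' [Ga|[x [y [Zx Zy n [-> -> ->]]]]]
      [Ga'|[x' [y' [Zx' Zy' n' [-> -> ->]]]]].
    * exact: Gi.
    * have [Xa Xb] := GX _ _ _ Ga; have [_ _ Xc] := GD _ _ _ Ga.
      split=> [e|[ea eb]]; last by case: n'; rewrite -ea -eb.
      by case: (g'N _ (FX _ _ Zx' Zy')); rewrite -/(F x' y') -e.
    * have [Xa Xb] := GX _ _ _ Ga'; have [_ _ Xc] := GD _ _ _ Ga'.
      split=> [e|[ea eb]]; last by case: n; rewrite ea eb.
      by case: (g'N _ (FX _ _ Zx Zy)); rewrite -/(F x y) e.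
    * by split=> [/Fi|[-> ->]] //; apply.
  + move=> a b c; suff h : G' ((a, b), c) -> [/\ Z a, Z b & Z c].
      by move=> /h [? ? ?]; split; apply/DG'.
    move=> [/GD [? ? ?]|[x [y [Zx Zy n [-> -> ->]]]]].
      by split; left.
    by split=> //; apply: ZF.
  + move=> a b /DG' Za /DG' Zb; have [[Xa Xb]|n] := pselect (X a /\ X b).
      by have [c Gc] := Gt _ _ Xa Xb; exists c; left.
    by exists (F a b); right; exists a, b.
- by move=> t; left.
Qed.

End Hessenberg.

Lemma In_map (A B : Type) (f : A -> B) (s : list A) (y : B) :
  List.In y (map f s) <-> exists x, f x = y /\ List.In x s.
Proof.
elim: s => [|a s IH] /=; first by split=> // -[x []].
split=> [[<-|/IH [x [<- xs]]]|[x [e [->|xs]]]].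
- by exists a; split; [|left].
- by exists x; split; [|right].
- by rewrite -e; left.
- by right; apply/IH; exists x.
Qed.

Lemma mem_In (T : eqType) (x : T) (s : list T) : x \in s -> List.In x s.
Proof. by elim: s => //= y s IH; rewrite inE => /orP [/eqP ->|/IH]; [left|right]. Qed.

Lemma In_pmap (A B : Type) (f : A -> option B) (x : A) (y : B) (s : list A) :
  f x = Some y -> List.In x s -> List.In y (pmap f s).
Proof.
move=> fx; elim: s => //= a s IH [->|/IH ys]; first by rewrite fx; left.
by case: (f a) => //= b; right.
Qed.

Lemma card_le_image (A B : Type) (f : A -> B) (S : B -> Prop) :
  (forall b, S b -> exists a, f a = b) -> card_le {b | S b} A.
Proof.
move=> h; have [g gP] := choice (fun b : {b | S b} => h _ (svalP b)).
by exists g => -[b Sb] [c Sc] e; apply: eq_exist; have := gP (exist _ b Sb); rewrite e gP.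
Qed.

Lemma card_lt_le_trans (A B C : Type) : card_le A B -> card_lt B C -> card_lt A C.
Proof.
move=> AB [BC nCB]; split; first exact: card_le_trans AB BC.
by move=> CA; apply: nCB; apply: card_le_trans CA AB.
Qed.

Lemma card_lt_prod (A B C : Type) :
  infinite_type B -> card_lt A C -> card_lt B C -> card_lt (A * B) C.
Proof.
move=> iB AC BC; have [AB|BA] := card_le_total A B.
  apply: card_lt_le_trans BC; apply: card_le_trans (Hessenberg iB).
  exact: card_le_prod AB (card_le_refl _).
apply: card_lt_le_trans AC; apply: card_le_trans (Hessenberg _).
  exact: card_le_prod (card_le_refl _) BA.
exact: card_le_trans iB BA.
Qed.

Lemma card_le_sum_prod (A B : Type) :
  infinite_type A -> card_le B A -> card_le (A + B) A.
Proof.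
move=> iA [g gi]; apply: card_le_trans (Hessenberg iA).
have [u ui] := iA.
exists (fun p => match p with inl a => (u 0, a) | inr b => (u 1, g b) end).
by move=> [a|b] [a'|b'] // [] => [->|/ui|/ui|/gi ->].
Qed.

Lemma card_lt_sum (A B C I : Type) : infinite_type I -> card_lt I C ->
  card_lt A C -> card_lt B C -> card_lt (A + B) C.
Proof.
move=> iI IC.
have swap X Y : card_le (X + Y) (Y + X).
  exists (fun p => match p with inl a => inr a | inr b => inl b end).
  by move=> [a|b] [a'|b'] // [->].
suff le X Y : card_le X Y -> card_lt Y C -> card_lt (X + Y) C.
  move=> AC BC; have [AB|BA] := card_le_total A B; first exact: le.
  by apply: card_lt_le_trans (swap _ _) _; apply: le.
move=> XY YC; apply: card_lt_le_trans (swap _ _) _.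
have [YI|IY] := card_le_total Y I.
  apply: card_lt_le_trans IC; apply: card_le_trans (card_le_sum_prod iI (card_le_refl _)).
  exact: card_le_sum YI (card_le_trans XY YI).
by apply: card_lt_le_trans YC; apply: card_le_sum_prod XY; apply: card_le_trans iI IY.
Qed.

Lemma card_lt_union (B C I : Type) (P Q : B -> Prop) :
  infinite_type I -> card_lt I C -> card_lt {b | P b} C -> card_lt {b | Q b} C ->
  card_lt {b | P b \/ Q b} C.
Proof.
move=> iI IC PC QC; apply: card_lt_le_trans (card_lt_sum iI IC PC QC).
pose f (p : {b | P b} + {b | Q b}) :=
  match p with inl p => sval p | inr q => sval q end.
apply: (@card_le_image _ _ f) => b [Pb|Qb]; first by exists (inl (exist _ b Pb)).
by exists (inr (exist _ b Qb)).
Qed.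

(** Transfinite recursion with choice: [Q i g x] makes [x] acceptable at stage [i] after the earlier
    values of [g]. The first condition on [Q] says that it reads [g] only below [i]; the second asks
    for an acceptable value only when all earlier values were acceptable. *)
Lemma wf_choice (I : Type) (lt : I -> I -> Prop) (A : Type) (a0 : A)
    (Q : I -> (I -> A) -> A -> Prop) :
  well_founded lt ->
  (forall i g g' x, (forall j, lt j i -> g j = g' j) -> Q i g x -> Q i g' x) ->
  (forall i g, (forall j, lt j i -> Q j g (g j)) -> exists x, Q i g x) ->
  exists g, forall i, Q i g (g i).
Proof.
move=> wf Qext Qex.
pose F i (rec : forall j, lt j i -> A) := some_such a0
  (Q i (fun j => if pselect (lt j i) is left h then rec j h else a0)).
pose g := Fix wf (fun _ => A) F.
have gE i : g i = some_such a0 (Q i (fun j => if pselect (lt j i) is left _ then g j else a0)).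
  rewrite /g Fix_eq // => x f f' ff'.
  congr some_such; congr (Q x); apply: funext => j; case: pselect => // h.
exists g; elim/(well_founded_ind wf) => i IH; rewrite gE.
have e j : lt j i -> (if pselect (lt j i) is left _ then g j else a0) = g j.
  by case: pselect.
by apply: (Qext _ _ _ _ e); apply: some_suchP; have [x Qx] := Qex i g IH;
  exists x; apply: Qext Qx => j /e.
Qed.

(** * Well orders and regular cardinals *)

Section WellOrders.
Variable K : WellOrder.
Implicit Types x y z : K.

Lemma wo_irr x : ~ wo_lt x x.
Proof. by elim/(well_founded_ind (@wo_wf K)): x => x IH h; apply: (IH x). Qed.

Lemma wo_nltNgt x y : ~ wo_lt x y -> x = y \/ wo_lt y x.
Proof. by case: (wo_total x y). Qed.

Lemma wo_le_lt_trans x y z : ~ wo_lt y x -> wo_lt y z -> wo_lt x z.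
Proof. by move=> /wo_nltNgt [->//|]; apply: wo_trans. Qed.

Lemma wo_list_max (P : K -> Prop) (s : list K) :
  (forall x, List.In x s -> ~ P x) \/
  exists x, [/\ P x & forall y, List.In y s -> P y -> ~ wo_lt x y].
Proof.
elim: s => [|a s [IH|[x [Px xs]]]]; first by left.
  have [Pa|nPa] := pselect (P a); last by left=> x [<-|/IH].
  by right; exists a; split=> // y [->|/IH //] _; apply: wo_irr.
have [[Pa xa]|n] := pselect (P a /\ wo_lt x a).
  right; exists a; split=> // y [->|ys Py]; first by move=> _; apply: wo_irr.
  by move=> ay; apply: (xs y) => //; apply: wo_trans ay.
by right; exists x; split=> // y [<-|]; [move=> Pa xa; apply: n|apply: xs].
Qed.

Hypothesis Kreg : regular_cardinal K.

Lemma cardinal_seg_lt x : card_lt {y : K | wo_lt y x} K.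
Proof.
have le : card_le {y : K | wo_lt y x} K by exists sval => y z /eq_sig_hprop; apply.
by split=> // le'; apply: (Kreg.1 x); apply: Cantor_Bernstein.
Qed.

(** An unbounded range would be cofinal, hence equinumerous with [K] by regularity, and [K] would
    inject into [A]. *)
Lemma regular_bounded (A : Type) (f : A -> K) :
  card_lt A K -> exists x, forall a, wo_lt (f a) x.
Proof.
move=> [_ nKA]; apply: contrapT => /forallNP n.
have [_ [_ reg]] := Kreg; case: (reg (fun y => exists a, f a = y)).
  by move=> x; have /existsNP [a na] := n x; exists (f a); split=> //; exists a.
move=> h [h' _ hh']; apply: nKA.
by apply: card_le_trans (@card_le_image _ _ f _ (fun b => id)); exists h'; apply: can_inj hh'.
Qed.

Lemma cardinal_not_le_unit : ~ card_le K unit.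
Proof.
move=> [f fi]; have [_ [[u ui] _]] := Kreg.
have /fi /ui // : f (u 0) = f (u 1) by case: (f _); case: (f _).
Qed.

Lemma regular_no_max x : exists y, wo_lt x y.
Proof.
have [|y yP] := @regular_bounded unit (fun _ => x); last by exists y; apply: yP tt.
split; last exact: cardinal_not_le_unit.
by exists (fun _ => x) => -[] [].
Qed.

Lemma regular_above (s : list K) : exists y, forall x, List.In x s -> wo_lt x y.
Proof.
have [h|[m [_ hm]]] := wo_list_max (fun _ => True) s.
  have [_ [[u _] _]] := Kreg.
  by exists (u 0) => x xs; case: (h x xs).
have [y my] := regular_no_max m; exists y => x xs.
exact: wo_le_lt_trans (hm x xs _) my.
Qed.

Lemma cardinal_seg_le_lt x : card_lt {y : K | ~ wo_lt x y} K.
Proof.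
have [z xz] := regular_no_max x; apply: card_lt_le_trans (cardinal_seg_lt z).
apply: (@card_le_image _ _ sval) => y xy.
by exists (exist _ y (wo_le_lt_trans xy xz)).
Qed.

End WellOrders.

(** * Definable predicates *)

Section Syntax.
Variable L : Lang.
Implicit Types (t : term L) (p : form L).

Fixpoint term_subst (s : nat -> term L) t : term L :=
  match t with
  | tvar i => s i
  | tapp f args => tapp (fun i => term_subst s (args i))
  end.

Definition subst_up (s : nat -> term L) : nat -> term L :=
  fun n => if n is k.+1 then term_subst (fun i => tvar L i.+1) (s k) else tvar L 0.

Fixpoint form_subst (s : nat -> term L) p : form L :=
  match p with
  | fEq t1 t2 => fEq (term_subst s t1) (term_subst s t2)
  | fRel R args => fRel (fun i => term_subst s (args i))
  | fFalse => fFalse L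
  | fImp p1 p2 => fImp (form_subst s p1) (form_subst s p2)
  | fAll p1 => fAll (form_subst (subst_up s) p1)
  end.

Definition form_ren (r : nat -> nat) p := form_subst (fun i => tvar L (r i)) p.

Lemma eval_subst (A : Structure L) (e : nat -> A) s t :
  eval e (term_subst s t) = eval (fun i => eval e (s i)) t.
Proof. by elim: t => //= f args IH; congr fun_i; apply: funext. Qed.

Lemma sat_subst (A : Structure L) p (e : nat -> A) s :
  sat e (form_subst s p) = sat (fun i => eval e (s i)) p.
Proof.
elim: p e s => //= [t1 t2|R args|p1 IH1 p2 IH2|p IH] e s.
- by rewrite !eval_subst.
- by congr rel_i; apply: funext => i; rewrite eval_subst.
- by rewrite IH1 IH2.
- apply: eq_forall => a; rewrite IH; congr sat; apply: funext => -[|k] //=.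
  by rewrite eval_subst.
Qed.

Lemma sat_ren (A : Structure L) p (e : nat -> A) r :
  sat e (form_ren r p) = sat (e \o r) p.
Proof. exact: sat_subst. Qed.

Lemma term_fv_mono t k k' : k <= k' -> term_fv_lt k t -> term_fv_lt k' t.
Proof.
move=> kk'; elim: t => /= [i ik|f args IH h i]; first exact: leq_trans ik kk'.
exact: IH.
Qed.

Lemma form_fv_mono p k k' : k <= k' -> form_fv_lt k p -> form_fv_lt k' p.
Proof.
elim: p k k' => //= [t1 t2|R args|p1 IH1 p2 IH2|p IH] k k' kk'.
- by move=> [? ?]; split; apply: term_fv_mono kk' _.
- by move=> h i; apply: term_fv_mono kk' _.
- by move=> [? ?]; split; [apply: IH1 kk' _|apply: IH2 kk' _].
- exact: IH.
Qed.

Lemma ord_bound n (Q : 'I_n -> nat -> Prop) :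
  (forall i k k', k <= k' -> Q i k -> Q i k') -> (forall i, exists k, Q i k) ->
  exists k, forall i, Q i k.
Proof.
move=> mono ex; have [f fP] := choice ex; exists (\max_i f i) => i.
exact: mono (leq_bigmax i) (fP i).
Qed.

Lemma term_fvE t : exists k, term_fv_lt k t.
Proof.
elim: t => [i|f args IH]; first by exists i.+1 => /=.
by apply: (ord_bound _ IH) => i k k'; apply: term_fv_mono.
Qed.

Lemma form_fvE p : exists k, form_fv_lt k p.
Proof.
elim: p => /= [t1 t2|R args||p1 [k1 h1] p2 [k2 h2]|p [k h]].
- have [[k1 h1] [k2 h2]] := (term_fvE t1, term_fvE t2).
  exists (maxn k1 k2); split.
    exact: term_fv_mono (leq_maxl _ _) h1.
  exact: term_fv_mono (leq_maxr _ _) h2.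
- apply: (ord_bound _ (fun i => term_fvE (args i))) => i k k'.
  exact: term_fv_mono.
- by exists 0.
- exists (maxn k1 k2); split.
    exact: form_fv_mono (leq_maxl _ _) h1.
  exact: form_fv_mono (leq_maxr _ _) h2.
- by exists k; apply: form_fv_mono h.
Qed.

Lemma eval_fv (A : Structure L) (e e' : nat -> A) t k :
  term_fv_lt k t -> (forall i, i < k -> e i = e' i) -> eval e t = eval e' t.
Proof.
move=> + ee'; elim: t => /= [i /ee' //|f args IH h].
by congr fun_i; apply: funext => i; apply: IH.
Qed.

Lemma sat_fv (A : Structure L) p (e e' : nat -> A) k :
  form_fv_lt k p -> (forall i, i < k -> e i = e' i) -> sat e p = sat e' p.
Proof.
elim: p e e' k => //= [t1 t2|R args|p1 IH1 p2 IH2|p IH] e e' k.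
- by move=> [h1 h2] ee'; rewrite (eval_fv h1 ee') (eval_fv h2 ee').
- by move=> h ee'; congr rel_i; apply: funext => i; apply: eval_fv ee'.
- by move=> [h1 h2] ee'; rewrite (IH1 _ _ _ h1 ee') (IH2 _ _ _ h2 ee').
- move=> h ee'; apply: eq_forall => a; apply: (IH _ _ _ h) => -[|i] //=.
  by rewrite ltnS => /ee'.
Qed.

Lemma term_fv_subst t s k k' :
  term_fv_lt k t -> (forall i, i < k -> term_fv_lt k' (s i)) ->
  term_fv_lt k' (term_subst s t).
Proof.
by move=> + h; elim: t => /= [i /h //|f args IH ha i]; apply: IH.
Qed.

Lemma form_fv_subst p s k k' :
  form_fv_lt k p -> (forall i, i < k -> term_fv_lt k' (s i)) ->
  form_fv_lt k' (form_subst s p).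
Proof.
elim: p s k k' => //= [t1 t2|R args|p1 IH1 p2 IH2|p IH] s k k'.
- by move=> [h1 h2] h; split; apply: term_fv_subst h.
- by move=> ha h i; apply: term_fv_subst h.
- by move=> [h1 h2] h; split; [apply: IH1 h|apply: IH2 h].
- move=> hp h; apply: (IH _ _ _ hp) => -[|i] //=.
  by rewrite ltnS => /h ih; apply: term_fv_subst ih _ => j /=; rewrite ltnS.
Qed.

Definition lt_form : form L :=
  fRel (fun i : 'I_(rel_ar (lt_sym L)) => tvar L (if val i == 0 then 0 else 1)).

Lemma sat_lt_form (A : Structure L) (e : nat -> A) :
  sat e lt_form = ltM (e 0) (e 1).
Proof. by congr rel_i; apply: funext => i /=; case: ifP. Qed.

End Syntax.

Definition upd (X A : Type) (r : X -> A) (x : X) (a : A) : X -> A :=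
  fun y => if pselect (y = x) is left _ then a else r y.

Lemma upd_eq (X A : Type) (r : X -> A) x a : upd r x a x = a.
Proof. by rewrite /upd; case: pselect. Qed.

Lemma upd_neq (X A : Type) (r : X -> A) x a y : y <> x -> upd r x a y = r y.
Proof. by rewrite /upd; case: pselect. Qed.

Definition ex_on (X A : Type) (W : A -> Prop) (u : list X) (C : (X -> A) -> Prop)
    (r : X -> A) : Prop :=
  exists r', [/\ forall x, ~ List.In x u -> r' x = r x,
    forall x, List.In x u -> W (r' x) & C r'].

Lemma ex_on_cons (X A : Type) (W : A -> Prop) (x : X) u C (r : X -> A) :
  ex_on W (x :: u) C r <-> exists a, W a /\ ex_on W u C (upd r x a).
Proof.
split=> [[r' [off on Cr']]|[a [Wa [r' [off on Cr']]]]].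
  exists (r' x); split; first by apply: on; left.
  exists r'; split=> // y yu; last by apply: on; right.
  have [->|yx] := pselect (y = x); first by rewrite upd_eq.
  by rewrite upd_neq // off // => -[/esym|].
exists r'; split=> // y.
  by move=> /not_orP [yx yu]; rewrite off // upd_neq // => /esym.
have [yu _|yu [e|//]] := pselect (List.In y u); first exact: on.
by rewrite off // e upd_eq.
Qed.

Section Definability.
Variables (L : Lang) (M : Structure L).
Implicit Types (P : M -> Prop).

Definition pval (X : Type) (r : X -> M) (v : X + M) : M :=
  match v with inl x => r x | inr a => a end.

Definition allowed (X : Type) P (v : X + M) : Prop :=
  match v with inl _ => True | inr a => P a end.

(* The elements of [X] play the role of variables: [e] tells which element of
   [X] or which parameter in [P] is plugged into each de Bruijn variable. *)
Definition definable (X : Type) P (C : (X -> M) -> Prop) : Prop :=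
  exists (p : form L) (e : nat -> X + M),
    (forall k, allowed P (e k)) /\ forall r, C r <-> sat (pval r \o e) p.

Definition definable_fun (X : Type) (f : (X -> M) -> M) : Prop :=
  exists (t : term L) (e : nat -> X + M), forall r, f r = eval (pval r \o e) t.

Section Closure.
Variables (X : Type) (P : M -> Prop).
Implicit Types (C D : (X -> M) -> Prop) (r : X -> M).

Lemma definable_ext C D : (forall r, C r <-> D r) -> definable P C -> definable P D.
Proof.
by move=> CD [p [e [eP h]]]; exists p, e; split=> // r; rewrite -CD.
Qed.

Lemma definable_imp C D : definable P C -> definable P D ->
  definable P (fun r => C r -> D r).
Proof.
move=> [p [e [eP h]]] [q [e' [eP' h']]].
(* The two formulas come with different environments; the even variables go to the first and the odd
   ones to the second. *)
exists (fImp (form_ren double p) (form_ren (fun k => k.*2.+1) q)).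
exists (fun k => if odd k then e' k./2 else e k./2); split.
  by move=> k; case: ifP.
move=> r /=; rewrite !sat_ren h h'.
rewrite (_ : (_ \o _) \o double = pval r \o e); last first.
  by apply: funext => k /=; rewrite odd_double doubleK.
rewrite (_ : (_ \o _) \o _ = pval r \o e') //.
by apply: funext => k /=; rewrite odd_double /= uphalf_double.
Qed.

Lemma definable_all x C : definable P C ->
  definable P (fun r => forall a, C (upd r x a)).
Proof.
move=> [p [e [eP h]]].
(* Several de Bruijn variables may carry [x]; all of them are identified with the newly bound one,
   and the others are shifted. *)
pose f k := if pselect (e k = inl x) is left _ then 0 else k.+1.
exists (fAll (form_ren f p)), e; split=> // r /=.
suff E a : C (upd r x a) <-> sat (scons a (pval r \o e)) (form_ren f p).
  by split=> H a; apply/E.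
rewrite h sat_ren (_ : pval _ \o e = scons a (pval r \o e) \o f) //.
apply: funext => k; rewrite /f /=; case: pselect => [->|n] /=; first by rewrite upd_eq.
by case: (e k) n => //= y n; rewrite upd_neq // => yx; apply: n; rewrite yx.
Qed.

End Closure.

Lemma definable_mono (X : Type) P P' (C : (X -> M) -> Prop) :
  (forall a, P a -> P' a) -> definable P C -> definable P' C.
Proof.
move=> PP' [p [e [eP h]]]; exists p, e; split=> // k.
by move: (eP k); case: (e k) => //= a; apply: PP'.
Qed.

Lemma definable_sub (X Y : Type) P (C : (X -> M) -> Prop) (f : X -> Y + M) :
  (forall x, allowed P (f x)) -> definable P C ->
  definable P (fun r : Y -> M => C (fun x => pval r (f x))).
Proof.
move=> fP [p [e [eP h]]].
pose e' k := match e k with inl x => f x | inr a => inr a end.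
exists p, e'; split; first by move=> k; rewrite /e'; move: (eP k); case: (e k).
move=> r; rewrite h (_ : pval _ \o e = pval r \o e') // /e'.
by apply: funext => k /=; case: (e k).
Qed.

Lemma definable_vars (X Y : Type) P (C : (X -> M) -> Prop) (f : X -> Y) :
  definable P C -> definable P (fun r : Y -> M => C (r \o f)).
Proof. exact: (@definable_sub _ _ _ _ (inl \o f)). Qed.

Section Closure2.
Variables (X : Type) (P : M -> Prop) (v0 : X + M).
Hypothesis v0P : allowed P v0.
Implicit Types (C D : (X -> M) -> Prop) (r : X -> M).

(** An environment is a total function, so some allowed [v0] must be at hand to fill it, even for a
    formula without variables. *)
Lemma definable_const (Q : Prop) : definable P (fun _ : X -> M => Q).
Proof.
have [q|nq] := pselect Q.
  by exists (fImp (fFalse L) (fFalse L)), (fun _ => v0); split=> // r /=; split.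
by exists (fFalse L), (fun _ => v0); split=> // r /=; split.
Qed.

Lemma definable_not C : definable P C -> definable P (fun r => ~ C r).
Proof. by move=> dC; apply: definable_imp (definable_const _). Qed.

Lemma definable_and C D : definable P C -> definable P D ->
  definable P (fun r => C r /\ D r).
Proof.
move=> dC dD.
apply: definable_ext (definable_not (definable_imp dC (definable_not dD))) => r.
by split=> [H|[c d] /(_ c)//]; split; apply: contrapT => n; apply: H.
Qed.

Lemma definable_iff C D : definable P C -> definable P D ->
  definable P (fun r => C r <-> D r).
Proof. by move=> dC dD; apply: definable_and; apply: definable_imp. Qed.

Lemma definable_ex x C : definable P C ->
  definable P (fun r => exists a, C (upd r x a)).
Proof.
move=> /definable_not /(definable_all x) /definable_not; apply: definable_ext => r.
by rewrite -existsNP; split=> -[a] h; exists a; [apply: contrapT|].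
Qed.

Lemma definable_lt v w : allowed P v -> allowed P w ->
  definable P (fun r : X -> M => ltM (pval r v) (pval r w)).
Proof.
move=> vP wP; exists (lt_form L), (fun k => if k == 0 then v else w); split.
  by move=> k; case: ifP.
by move=> r; rewrite sat_lt_form.
Qed.

Lemma definable_list_all (T : Type) (l : list T) (C : T -> (X -> M) -> Prop) :
  (forall t, List.In t l -> definable P (C t)) ->
  definable P (fun r => forall t, List.In t l -> C t r).
Proof.
elim: l => [|a l IH] h.
  apply: definable_ext (definable_const True) => r.
  by split=> // _ t [].
apply: definable_ext (definable_and (h a _) (IH _)) => [r||t tl]; last 2 first.
- by left.
- by apply: h; right.
by split=> [[ha hl] t [<-|/hl]|hh] //; split=> [|t tl]; apply: hh; [left|right].
Qed.

Lemma definable_ex_on (W : M -> Prop) (u : list X) C :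
  definable P (fun r : unit -> M => W (r tt)) -> definable P C ->
  definable P (ex_on W u C).
Proof.
move=> dW dC; elim: u => [|x u IH].
  apply: definable_ext dC => r; split=> [Cr|[r' [e _]]]; first by exists r.
  by rewrite (_ : r' = r) //; apply: funext => x; apply: e => -[].
have dWx : definable P (fun r => W (r x)) := definable_vars (fun _ => x) dW.
apply: definable_ext (definable_ex x (definable_and dWx IH)) => r.
by rewrite ex_on_cons; split=> -[a []]; rewrite ?upd_eq; exists a; rewrite ?upd_eq.
Qed.

Lemma definable_all_list (W : M -> Prop) (u : list X) C :
  definable P (fun r : unit -> M => W (r tt)) -> definable P C ->
  definable P (fun r => forall r', (forall x, ~ List.In x u -> r' x = r x) ->
    (forall x, List.In x u -> W (r' x)) -> C r').
Proof.
move=> dW dC.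
apply: definable_ext (definable_not (definable_ex_on u dW (definable_not dC))) => r.
split=> [n r' off on|H [r' [off on n]]]; last exact: n (H r' off on).
by apply: contrapT => nC; apply: n; exists r'.
Qed.

End Closure2.

(** Only the elements of [X] plugged into the finitely many free variables of the formula matter. *)
Lemma definable_finsupp (X : Type) P (C : (X -> M) -> Prop) :
  definable P C -> exists s : list X, forall r r' : X -> M,
    (forall x, List.In x s -> r x = r' x) -> (C r <-> C r').
Proof.
move=> [p [e [_ h]]]; have [N fvN] := form_fvE p.
exists (pmap (fun k => if e k is inl x then Some x else None) (iota 0 N)) => r r' rr'.
rewrite !h (sat_fv (e' := pval r' \o e) fvN) // => i iN /=.
case E: (e i) => [x|a] //=; apply: rr'.
by apply: (@In_pmap _ _ _ i); [rewrite E|apply: mem_In; rewrite mem_iota].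
Qed.

(** Only the parameters at the free variables matter; every other position is filled with the
    variable [x0]. *)
Lemma definable_finparam (X : Type) P (C : (X -> M) -> Prop) (x0 : X) :
  definable P C -> exists s : list M, forall P' : M -> Prop,
    (forall a, List.In a s -> P' a) -> definable P' C.
Proof.
move=> [p [e [_ h]]]; have [N fvN] := form_fvE p.
exists (pmap (fun k => if e k is inr x then Some x else None) (iota 0 N)) => P' sP'.
exists p, (fun k => if k < N then e k else inl x0); split=> [k|r]; last first.
  by rewrite h (sat_fv (e' := pval r \o fun k => if k < N then e k else inl x0) fvN) // => i /= ->.
case: ifP => // kN; case E: (e k) => [x|a] //=; apply: sP'.
by apply: (@In_pmap _ _ _ k); [rewrite E|apply: mem_In; rewrite mem_iota].
Qed.

Lemma definable_fun_family (X : Type) (F : nat -> (X -> M) -> M) :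
  (forall k, definable_fun (F k)) -> exists (s : nat -> term L) (e : nat -> X + M),
    forall k r, F k r = eval (pval r \o e) (s k).
Proof.
move=> /choice [t /choice [e te]].
(* The environments of all the [F k] are packed into one: variable [i] of the [k]-th term becomes
   the code of the pair [(k, i)]. *)
exists (fun k => term_subst (fun i => tvar L (pickle (k, i))) (t k)).
exists (fun n => if unpickle n is Some (k, i) then e k i else e 0 0) => k r.
rewrite te eval_subst; congr eval; apply: funext => i /=.
by rewrite pickleK.
Qed.

Lemma definable_sat (X : Type) (F : nat -> (X -> M) -> M) (p : form L) :
  (forall k, definable_fun (F k)) ->
  definable (fun _ => True) (fun r => sat (F^~ r) p).
Proof.
move=> /definable_fun_family [s [e se]].
exists (form_subst s p), e; split=> [k|r]; first by case: (e k).
by rewrite sat_subst (_ : F^~ r = fun i => eval (pval r \o e) (s i)) //; apply: funext.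
Qed.

Lemma definable_fun_eval (X : Type) (F : nat -> (X -> M) -> M) (t : term L) :
  (forall k, definable_fun (F k)) -> definable_fun (fun r => eval (F^~ r) t).
Proof.
move=> /definable_fun_family [s [e se]].
exists (term_subst s t), e => r.
by rewrite eval_subst (_ : F^~ r = fun i => eval (pval r \o e) (s i)) //; apply: funext.
Qed.

Lemma definable_fun_val (X : Type) (v : X + M) : definable_fun (fun r => pval r v).
Proof. by exists (tvar L 0), (fun _ => v). Qed.

End Definability.

(** * Regularity *)

Definition join (I J A : Type) (c : I -> A) (d : J -> A) (v : I + J) : A :=
  match v with inl i => c i | inr j => d j end.

Lemma join_comp (I J A : Type) (r : I + J -> A) : r = join (r \o inl) (r \o inr).
Proof. by apply: funext => -[]. Qed.

Section Regularity.
Variables (L : Lang) (M : Structure L).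
Local Notation "a ≺ b" := (@ltM L M a b) (at level 70).
Hypothesis lt_irr : forall a : M, ~ a ≺ a.
Hypothesis lt_trans : forall a b c : M, a ≺ b -> b ≺ c -> a ≺ c.
Hypothesis lt_total : forall a b : M, a ≺ b \/ a = b \/ b ≺ a.
Hypothesis scheme : forall (n m : nat) (phi : form L), form_fv_lt (n + m) phi ->
  forall z0 : M, exists z1 : M, z0 ≺ z1 /\
    forall y0 : nat -> M, exists y1 : nat -> M,
      (forall i, (i < n)%N -> y1 i ≺ z1) /\
      forall t : nat -> M, (forall j, (j < m)%N -> t j ≺ z0) ->
        (sat (tup_env n y0 t) phi <-> sat (tup_env n y1 t) phi).

Lemma nlt_lt_trans (a b c : M) : ~ b ≺ a -> b ≺ c -> a ≺ c.
Proof. by case: (lt_total a b) => [ab|[->//|//]] _; apply: lt_trans. Qed.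

Lemma nlt_trans (a b c : M) : ~ b ≺ a -> ~ c ≺ b -> ~ c ≺ a.
Proof. by move=> ba cb ca; apply: ba; apply: nlt_lt_trans cb ca. Qed.

Lemma lt_nlt (a b : M) : a ≺ b -> ~ b ≺ a.
Proof. by move=> ab ba; apply: (lt_irr (lt_trans ab ba)). Qed.

Lemma no_last (z : M) : exists z1, z ≺ z1.
Proof.
by have [//|z1 [zz1 _]] := @scheme 0 0 (fFalse L) _ z; exists z1.
Qed.

Lemma list_above (s : list M) : exists z, forall a, List.In a s -> a ≺ z.
Proof.
elim: s => [|b s [z zP]]; first by exists (inh M).
have [w bw] := no_last b.
have [zw|wz] := pselect (z ≺ w).
  by exists w => a [<-//|/zP az]; apply: lt_trans zw.
exists z => a [<-|/zP //]; case: (lt_total z w) => [//|[->//|]].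
exact: lt_trans bw.
Qed.

(** As parameter sets, [none] gives definability without parameters and [any] definability with
    arbitrary parameters from [M]. *)
Definition none : M -> Prop := fun _ => False.
Definition any : M -> Prop := fun _ => True.

Lemma scheme_definable (I : Type) (R : (I + nat -> M) -> Prop) (z0 : M) :
  definable none R -> exists z1, z0 ≺ z1 /\ forall c : I -> M, exists c' : I -> M,
    (forall i, c' i ≺ z1) /\ forall t : nat -> M, (forall k, t k ≺ z0) ->
      (R (join c t) <-> R (join c' t)).
Proof.
move=> [p [e [eP h]]]; have [N fvN] := form_fvE p.
pose at_ i k := k < N /\ e k = inl (inl i).
pose kf i := some_such 0 (at_ i).
have kfP i k : at_ i k -> at_ i (kf i) by move=> ik; apply: some_suchP; exists k.
(* An index [i] may sit at several de Bruijn positions; all are merged at the position [kf i] below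
   [N]. Everything else moves past [N], where the scheme expects its bounded parameters. *)
pose r k := match e k with inl (inl i) => kf i | _ => N + k end.
have fvr : form_fv_lt (N + N) (form_ren r p).
  apply: form_fv_subst fvN _ => k kN /=; rewrite /r.
  case E: (e k) => [[i|n]|a]; rewrite ?ltn_add2l //.
  by have [|lt_kf _] := kfP i k; [split|exact: ltn_addr].
have [z1 [z01 H]] := scheme fvr z0; exists z1; split=> // c.
pose y0 k := match e k with inl (inl i) => c i | _ => z0 end.
have [y1 [y1z H1]] := H y0.
pose c' i := if pselect (exists k, at_ i k) is left _ then y1 (kf i) else z0.
exists c'; split=> [i|t tz].
  by rewrite /c'; case: pselect => // -[k /kfP [kN _]]; apply: y1z.
pose t' k := match e k with inl (inr n) => t n | _ => t 0 end.
have {H1} := H1 t'; rewrite !sat_ren !h => H1.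
have E y d : (forall i k, at_ i k -> y (kf i) = d i) ->
  sat (tup_env N y t' \o r) p = sat (pval (join d t) \o e) p.
  move=> yd; apply: (sat_fv fvN) => k kN /=; rewrite /r /tup_env.
  move: (eP k); case E: (e k) => [[i|n]|a] //= _.
    have ik : at_ i k by split.
    by have [-> _] := kfP i k ik; apply: yd ik.
  by rewrite ltnNge leq_addr /= addKn /t' E.
rewrite -(E y0 c) => [|i k /kfP [_ e_kf]]; last by rewrite /y0 e_kf.
rewrite -(E y1 c') => [|i k ik]; last by rewrite /c'; case: pselect => // -[]; exists k.
by apply: H1 => j _; rewrite /t'; case: (e j) => [[i|n]|a].
Qed.

(** The scheme gives [z1] such that every [w] has a counterpart w' below [z1]: for all [b] below [z]
    at once, an [a] above [w] satisfies [C] with [b] iff some [a] above w' does. Some [a0] above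
    [z1] comes with a [b0]. It is a witness for [b0] above w', hence there is one above [w], and
    [b0] works for every [w]. *)
Lemma regularity (X : Type) (C : (X -> M) -> Prop) (x y : X) (r : X -> M) (z : M) :
  definable any C -> x <> y ->
  (forall w, exists a, w ≺ a /\ exists b, b ≺ z /\ C (upd (upd r x a) y b)) ->
  exists b, b ≺ z /\ forall w, exists a, w ≺ a /\ C (upd (upd r x a) y b).
Proof.
move=> [p [e [_ h]]] xy ubd; have [N fvN] := form_fvE p.
(* [true] stands for [x] and [false] for the lower bound on it; all other arguments, [y] included,
   become numbered parameters, which are kept below [z0]. *)
pose e0 k : (bool + nat) + M :=
  if pselect (e k = inl x) is left _ then inl (inl true) else inl (inr k).
pose D (q : bool + nat -> M) :=
  q (inl false) ≺ q (inl true) /\ sat (pval q \o e0) p.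
pose v0 : (bool + nat) + M := inl (inl true).
have v0P : allowed none v0 by [].
have dD : definable none D.
  apply: (definable_and v0P).
    exact: (@definable_lt _ _ _ _ (inl (inl false)) (inl (inl true))).
  by exists p, e0; split=> // k; rewrite /e0; case: pselect.
have [z0 z0P] := list_above (z :: [seq pval r (e k) | k <- iota 0 N]).
have zz0 : z ≺ z0 by apply: z0P; left.
have rz0 k : k < N -> pval r (e k) ≺ z0.
  move=> kN; apply: z0P; right; apply/In_map; exists k; split=> //.
  by apply: mem_In; rewrite mem_iota.
have [z1 [_ H]] := scheme_definable z0 (definable_ex v0P (inl true) dD).
pose t b k := if k < N then pval (upd r y b) (e k) else z.
have tz b k : b ≺ z -> t b k ≺ z0.
  move=> bz; rewrite /t; case: ifP => // kN; move: (rz0 k kN).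
  case: (e k) => [v|v] //=; rewrite /upd; case: pselect => // _ _.
  exact: lt_trans bz zz0.
have E c b : (exists a, D (upd (join c (t b)) (inl true) a)) <->
    exists a, c false ≺ a /\ C (upd (upd r x a) y b).
  suff E a : D (upd (join c (t b)) (inl true) a) <->
      c false ≺ a /\ C (upd (upd r x a) y b).
    by split=> -[a /E]; exists a.
  rewrite /D upd_eq upd_neq // h; suff -> : sat (pval (upd (join c (t b)) (inl true) a) \o e0) p
    = sat (pval (upd (upd r x a) y b) \o e) p by [].
  apply: (sat_fv fvN) => k kN /=; rewrite /e0; case: pselect => [->|n] /=.
    by rewrite upd_eq upd_neq // upd_eq.
  rewrite upd_neq //= /t kN; case: (e k) n => [v|v] //= n.
  rewrite /upd; case: pselect => // _; case: pselect => // vx.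
  by case: n; rewrite vx.
apply: contrapT => /forallNP nb.
have [a0 [z1a0 [b0 [b0z Cab]]]] := ubd z1.
have /existsNP [w nw] : ~ forall w, exists a, w ≺ a /\ C (upd (upd r x a) y b0).
  by move=> hw; apply: (nb b0).
have [c' [c'z1 Hc]] := H (fun _ => w).
apply/nw/(E (fun _ => w) b0)/Hc => [k|]; first exact: tz.
by apply/E; exists a0; split=> //; apply: lt_trans z1a0.
Qed.

(** * The quantifier [for unboundedly many] and its iterates *)

Section Quantifiers.
Variable X : Type.
Implicit Types (C D : (X -> M) -> Prop) (r : X -> M) (s u : list X).

(** The head of the list is the outermost quantifier: each variable is chosen far out after the
    values of the preceding ones. *)
Fixpoint Qs s C r : Prop :=
  match s with
  | nil => C r
  | cons x s' => forall w, exists a, w ≺ a /\ Qs s' C (upd r x a)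
  end.

Lemma Qs_mono s C D r : (forall r, C r -> D r) -> Qs s C r -> Qs s D r.
Proof.
move=> CD; elim: s r => [|x s IH] r /=; first exact: CD.
by move=> H w; have [a [wa /IH Da]] := H w; exists a.
Qed.

Lemma Qs_ex s C r : Qs s C r -> exists r', C r'.
Proof.
elim: s r => [|x s IH] r /=; first by exists r.
by move=> /(_ (inh M)) [a [_ /IH]].
Qed.

Lemma Qs_True s r : Qs s (fun _ => True) r.
Proof.
elim: s r => [|x s IH] r //= w.
by have [a wa] := no_last w; exists a.
Qed.

Lemma definable_Qs P s C : definable P C -> definable P (Qs s C).
Proof.
move=> dC; elim: s => [|x s IH] //=.
pose D (q : option X -> M) := q None ≺ q (Some x) /\ Qs s C (q \o Some).
have v0P : allowed P (inl (Some x) : option X + M) by [].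
have dD : definable P D.
  apply: (definable_and v0P); last exact: definable_vars IH.
  exact: (@definable_lt _ _ _ _ (inl None) (inl (Some x))).
have := definable_vars (odflt x) (definable_all None (definable_ex v0P (Some x) dD)).
apply: definable_ext => r.
have E w a : D (upd (upd (r \o odflt x) None w) (Some x) a) <->
    w ≺ a /\ Qs s C (upd r x a).
  rewrite /D upd_eq upd_neq // upd_eq.
  rewrite (_ : _ \o Some = upd r x a) //; apply: funext => y /=.
  have [->|yx] := pselect (y = x); first by rewrite !upd_eq.
  by rewrite !upd_neq // => -[].
by split=> H w; have [a /E ?] := H w; exists a.
Qed.

Lemma definable_below P z : P z -> definable P (fun r : unit -> M => r tt ≺ z).
Proof. by move=> Pz; apply: (@definable_lt _ _ _ _ (inl tt) (inr z)). Qed.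

(** Bounded existential quantifiers pass in front of [for unboundedly many], one variable of [u] at
    a time, by [regularity]. *)
Lemma Q_swap x u z C r : definable any C -> ~ List.In x u ->
  (forall w, exists a, w ≺ a /\ ex_on (fun b => b ≺ z) u C (upd r x a)) ->
  ex_on (fun b => b ≺ z) u (fun r => forall w, exists a, w ≺ a /\ C (upd r x a)) r.
Proof.
move=> dC; elim: u r => [|y u IH] r xu H.
  exists r; split=> // w; have [a [wa [r' [off _ Cr']]]] := H w.
  by exists a; rewrite -(_ : r' = upd r x a) //; apply: funext => y; apply: off.
have /not_orP [yx {}xu] := xu.
have dE : definable any (ex_on (fun b => b ≺ z) u C).
  by apply: (@definable_ex_on _ _ _ _ (inl x)) => //; apply: definable_below.
have [//||b [bz Hb]] := @regularity _ _ x y r z dE _.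
- by move/esym.
- by move=> w; have [a [wa /ex_on_cons ?]] := H w; exists a.
apply/ex_on_cons; exists b; split=> //; apply: IH => // w.
have [a [wa Ha]] := Hb w; exists a; split=> //.
rewrite (_ : upd _ x a = upd (upd r x a) y b) //; apply: funext => v; rewrite /upd.
by case: pselect => vx; case: pselect => // vy; case: yx; rewrite -vy.
Qed.

Lemma Qs_swap s u z C r : definable any C ->
  (forall x, List.In x s -> ~ List.In x u) ->
  Qs s (ex_on (fun b => b ≺ z) u C) r -> ex_on (fun b => b ≺ z) u (Qs s C) r.
Proof.
move=> dC; elim: s r => [|x s IH] r //= su H.
apply: Q_swap; [exact: definable_Qs|by apply: su; left|] => w.
have [a [wa Ha]] := H w; exists a; split=> //; apply: IH => // y ys.
by apply: su; right.
Qed.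

End Quantifiers.

Lemma Qs_inl (I J : Type) (s : list I) (F : (I + J -> M) -> Prop) b d :
  Qs (map inl s) F (join b d) <-> Qs s (fun x => F (join x d)) b.
Proof.
elim: s b => [|i s IH] b //=.
have E a : upd (join b d) (inl i) a = join (upd b i a) d.
  apply: funext => -[j|j] /=; last by rewrite upd_neq.
  have [->|ji] := pselect (j = i); first by rewrite !upd_eq.
  by rewrite !upd_neq // => -[].
by split=> H w; have [a [wa Ha]] := H w; exists a; split=> //; move: Ha; rewrite E IH.
Qed.

(** * Types over initial segments *)

Section Agreement.
Variable I : Type.
Implicit Types (R : (I + nat -> M) -> Prop) (c d : I -> M) (m : M).

(** Equality of the [R]-types of [c] and [d] over the initial segment up to and including [m]. *)
Definition agree R m c d : Prop := forall t : nat -> M, (forall k, ~ m ≺ t k) ->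
  (R (join c t) <-> R (join d t)).

Lemma agree_sym R m c d : agree R m c d -> agree R m d c.
Proof. by move=> h t /h [? ?]; split. Qed.

Lemma agree_trans R m c d f : agree R m c d -> agree R m d f -> agree R m c f.
Proof. by move=> h1 h2 t mt; apply: iff_trans (h1 t mt) (h2 t mt). Qed.

Lemma agree_le R m m' c d : ~ m' ≺ m -> agree R m' c d -> agree R m c d.
Proof. by move=> mm' h t mt; apply: h => k; apply: nlt_trans (mt k) mm'. Qed.

(** Only finitely many entries of [t] matter to [R], so quantifying over all sequences [t] amounts
    to finitely many bounded quantifiers. The remaining entries are set to [m], which lies in the
    segment. *)
Lemma definable_agree (P : M -> Prop) R m : definable none R -> P m ->
  definable P (fun r : I + I -> M => agree R m (r \o inl) (r \o inr)).
Proof.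
move=> dR Pm; have [s sP] := definable_finsupp dR.
have {}dR : definable P R by apply: definable_mono dR => a [].
pose u := pmap (fun v => if v is inr k then Some k else None) s.
have uP k : List.In (inr k) s -> List.In k u by apply: In_pmap.
pose W a := ~ m ≺ a.
pose fl (i : I) : (I + I) + nat := inl (inl i).
pose fr (i : I) : (I + I) + nat := inl (inr i).
pose C1 (r : (I + I) + nat -> M) :=
  R (r \o join fl inr) <-> R (r \o join fr inr).
have v0P X : allowed P (inr m : X + M) by [].
have dC1 : definable P C1 by apply: (definable_iff (v0P _)); apply: definable_vars.
have dW : definable P (fun r : unit -> M => W (r tt)).
  apply: (definable_not (v0P _)).
  exact: (@definable_lt _ _ _ _ (inr m) (inl tt)).
have dC2 := definable_all_list (v0P _) (map inr u) dW dC1.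
pose f (v : (I + I) + nat) : (I + I) + M := match v with inl w => inl w | inr _ => inr m end.
have fP v : allowed P (f v) by case: v.
apply: definable_ext (definable_sub fP dC2) => r.
split=> [H t mt|H r' off on].
  pose r' : (I + I) + nat -> M :=
    join r (fun k => if pselect (List.In k u) is left _ then t k else m).
  have : C1 r'.
    apply: H => [[v|k] /= n|v /In_map [k [<- ku]]] //=.
    - by case: pselect => // ku; case: n; apply/In_map; exists k.
    - by case: pselect => // _; apply: mt.
  have E (g : I -> (I + I) + nat) (q : I -> M) : (forall i, r' (g i) = q i) ->
      R (r' \o join g inr) <-> R (join q t).
    move=> gq; apply: sP => -[i|k] ks /=; first exact: gq.
    by case: pselect => // n; case: n; apply: uP.
  by rewrite /C1 (E fl (r \o inl)) // (E fr (r \o inr)).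
have offl v : r' (inl v) = r v by rewrite off // => /In_map [k []].
have := H (r' \o inr); rewrite /C1.
have E (g : I -> (I + I) + nat) (q : I -> M) : (forall i, r' (g i) = q i) ->
    r' \o join g inr = join q (r' \o inr).
  by move=> gq; apply: funext => -[].
rewrite (E fl (r \o inl)) ?(E fr (r \o inr)); try by move=> i; rewrite /= offl.
apply=> k /=; have [ku|nk] := pselect (List.In k u).
  by apply: on; apply/In_map; exists k.
rewrite off => [|/In_map [k' [[k'k] k'u]]]; first exact: lt_irr.
by apply: nk; rewrite -k'k.
Qed.

(* Every type over an initial segment has a bounded realization, so by
   regularity one of them is realized unboundedly often. *)
Lemma Qs_refine (s : list I) (l : list ((I + nat -> M) -> Prop)) m
    (C : (I -> M) -> Prop) b :
  (forall R, List.In R l -> definable none R) -> definable any C -> Qs s C b ->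
  exists c, C c /\ Qs s (fun x => C x /\ forall R, List.In R l -> agree R m x c) b.
Proof.
elim: l C => [|R l IH] C dl dC QC.
  have [c Cc] := Qs_ex QC; exists c; split=> //.
  by apply: Qs_mono QC.
have dR : definable none R by apply: dl; left.
have [z0 mz0] := no_last m.
have [z1 [_ bdd]] := scheme_definable z0 dR.
pose E (r : I + I -> M) := C (r \o inl) /\ agree R m (r \o inl) (r \o inr).
have v0P X : allowed any (inr m : X + M) by [].
have dE : definable any E.
  apply: (definable_and (v0P _)); first exact: definable_vars.
  exact: definable_agree.
have [s0 s0P] := definable_finsupp dE.
pose u : list (I + I) := List.filter (fun v => if v is inr _ then true else false) s0.
have uP i : List.In (inr i) s0 -> List.In (inr i : I + I) u.
  by move=> h; apply/List.filter_In.
have ul i : ~ List.In (inl i : I + I) u by move=> /List.filter_In [].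
(* Each [x] satisfying [C] shares its [R]-type up to [m] with some tuple below [z1]. [Qs_swap] then
   fixes one tuple [c1] whose type occurs unboundedly often. *)
have : Qs (map inl s) (ex_on (fun a => a ≺ z1) u E) (join b b).
  apply/Qs_inl; apply: Qs_mono QC => x Cx; have [c' [c'z H]] := bdd x.
  exists (join x (fun i => if pselect (List.In (inr i : I + I) u) is left _ then c' i else b i)).
  split.
  - by move=> [i|i] //=; case: pselect.
  - by move=> [i /ul //|i] /=; case: pselect.
  - suff : E (join x c').
      apply: (s0P _ _ _).1 => -[i|i] //= si.
      by case: pselect => // n; case: n; apply: uP.
    by split=> // t mt; apply: H => k; apply: nlt_lt_trans (mt k) mz0.
move/(Qs_swap dE) => [].
  by move=> v /In_map [i [<- _]]; apply: ul.
move=> r' [off _]; rewrite (join_comp r').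
have -> : r' \o inl = b by apply: funext => i /=; rewrite off.
set c1 := r' \o inr => /Qs_inl QC'.
(* The induction hypothesis is applied to this refined condition. The [c] it yields has the [R]-type
   of [c1], so agreement with [c1] becomes agreement with [c]. *)
pose C' x := E (join x c1).
have dC' : definable any C'.
  have fP v : allowed any (join inl (inr \o c1) v : I + M) by case: v.
  apply: definable_ext (definable_sub fP dE) => x; rewrite /C'.
  suff -> : (fun v => pval x (join inl (inr \o c1) v)) = join x c1 by [].
  by apply: funext => -[].
have [|c [C'c Qc]] := IH C' _ dC' QC'; first by move=> R' R'l; apply: dl; right.
exists c; split; first by case: C'c.
apply: Qs_mono Qc => x [[Cx a1] a2]; split=> // R' [<-|R'l]; last exact: a2.
by apply: agree_trans a1 _; apply: agree_sym; case: C'c.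
Qed.

End Agreement.
End Regularity.

(** * Types in many variables *)

Section SaturatedFamilies.
Variables (L : Lang) (M : Structure L) (K Lam : WellOrder).
Hypothesis Msat : kappa_saturated K M.
Hypothesis Laminf : infinite_type Lam.
Hypothesis LamK : card_lt Lam K.
Variables (P : M -> Prop) (S : ((Lam -> M) -> Prop) -> Prop) (a0 : M).
Hypothesis PK : card_lt {a | P a} K.
Hypothesis Pa0 : P a0.
Hypothesis Sdef : forall C, S C -> definable P C.
Hypothesis Ssat : forall l, (forall C, List.In C l -> S C) ->
  exists c, forall C, List.In C l -> C c.

(** The invariant of the recursion along [Lam]: [S] stays finitely satisfiable once the values of
    [g] below [al] and the value [a] at [al] are fixed. *)
Let extends (g : Lam -> M) (al : Lam) (a : M) : Prop :=
  forall l, (forall C, List.In C l -> S C) ->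
    exists c, [/\ forall be, wo_lt be al -> c be = g be, c al = a
      & forall C, List.In C l -> C c].

Let conj_definable l : (forall C, List.In C l -> S C) ->
  definable P (fun c => forall C, List.In C l -> C c).
Proof.
move=> lS; apply: (@definable_list_all _ _ _ _ (inr a0) _ _ l (fun C c => C c)) => //.
by move=> C /lS /Sdef.
Qed.

(** A finite part of [S] mentions finitely many indices; the invariant at the largest of them in [D]
    already fixes all the values concerned. This covers limit stages and the end of the
    recursion. *)
Let extends_downset (D : Lam -> Prop) g l :
  (forall al be, D al -> wo_lt be al -> D be) ->
  (forall al, D al -> extends g al (g al)) -> (forall C, List.In C l -> S C) ->
  exists c, (forall al, D al -> c al = g al) /\ forall C, List.In C l -> C c.
Proof.
move=> Ddown Dg lS; have [s sP] := definable_finsupp (conj_definable lS).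
suff [c [cg cl]] : exists c, (forall al, List.In al s -> D al -> c al = g al) /\
    forall C, List.In C l -> C c.
  exists (fun al => if pselect (D al) is left _ then g al else c al); split=> [al Dal|].
    by case: pselect.
  apply/(sP _ c) => // al als; case: pselect => // Dal.
  by rewrite cg.
have [nD|[m [Dm mP]]] := wo_list_max D s.
  by have [c cl] := Ssat lS; exists c; split=> // al /nD.
have [c [cg cm cl]] := Dg m Dm l lS; exists c; split=> // al als Dal.
by case: (wo_nltNgt (mP al als Dal)) => [<-|/cg].
Qed.

(** Saturation over [P] and the earlier values, fewer than [K] parameters in all, realizes the
    1-type saying that every finite part of [S] has a solution through these values and [a]. *)
Let extends_exists g al : (forall be, wo_lt be al -> extends g be (g be)) ->
  exists a, extends g al a.
Proof.
move=> gE.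
pose P' a := P a \/ exists be, wo_lt be al /\ g be = a.
have P'K : card_lt {a | P' a} K.
  apply: (card_lt_union Laminf) => //; apply: card_lt_le_trans LamK.
  by apply: (@card_le_image _ _ g) => a [be [_ e]]; exists be.
pose D l a := exists c, [/\ forall be, wo_lt be al -> c be = g be, c al = a
      & forall C, List.In C l -> C c].
(* The type consists of the formulas over [P'] that express [D l] for some finite part [l] of [S].
   Concatenating lists reduces a finite subset of it to a single [l]. *)
pose p (q : form L * (nat -> M)) := (forall k, P' (q.2 k)) /\
  exists l, (forall C, List.In C l -> S C) /\ forall a, sat (scons a q.2) q.1 <-> D l a.
have v0P X : allowed P' (inr a0 : X + M) by left.
have Dform l : (forall C, List.In C l -> S C) -> exists phi (e : nat -> M),
    (forall k, P' (e k)) /\ forall a, sat (scons a e) phi <-> D l a.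
  move=> lS; have dl : definable P' (fun c => forall C, List.In C l -> C c).
    by apply: definable_mono (conj_definable lS) => a; left.
  have [s sP] := definable_finsupp dl.
  pose u := List.filter (fun be => `[< be <> al >]) s.
  pose f be : Lam + M := if pselect (wo_lt be al) is left _ then inr (g be) else inl be.
  have fP be : allowed P' (f be).
    by rewrite /f; case: pselect => //= ba; right; exists be.
  have dT : definable P' (fun r : unit -> M => (fun _ => True) (r tt)).
    exact: (definable_const (v0P _)).
  (* Indices before [al] are replaced by their values, and the indices of the support other than
     [al] are quantified away. The remaining variables are then identified, which leaves one free
     variable. *)
  have := definable_ex_on (W := fun _ => True) (v0P _) u dT (definable_sub fP dl).
  move=> /(@definable_vars _ _ _ _ _ _ (fun _ => tt)) [phi [e [eP he]]].
  exists (form_ren (fun k => if e k is inl _ then 0 else k.+1) phi).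
  exists (fun k => if e k is inr a then a else a0); split=> [k|a].
    by move: (eP k); case: (e k) => //= _ _; left.
  rewrite sat_ren.
  rewrite (_ : _ \o _ = pval (fun _ => a) \o e); last first.
    by apply: funext => k /=; case E: (e k) => [[]|b] //=; rewrite E.
  rewrite -he; split=> [[r' [off _ Cr']]|[c [cg ca cl]]].
    exists (fun be => pval r' (f be)); split=> //.
      by move=> be; rewrite /f; case: pselect.
    rewrite /f; case: pselect => [/wo_irr//|_] /=.
    by rewrite off //= => /List.filter_In [_ /asboolP].
  exists (fun be => if pselect (List.In be u) is left _ then c be else a); split=> //.
    by move=> be nu; case: pselect.
  apply/(sP _ c) => // be bes; rewrite /f; case: pselect => [/cg //|_] /=.
  case: pselect => // nu; rewrite -ca; congr c; apply: contrapT => ne; apply: nu.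
  by apply/List.filter_In; split=> //; apply/asboolP => /esym.
have [q [qP _]|qs qsp|a aP] := @Msat P' P'K p.
- exact: qP.
- have [l [lS lq]] : exists l, (forall C, List.In C l -> S C) /\
      forall q, List.In q qs -> forall a, D l a -> sat (scons a q.2) q.1.
    elim: qs qsp => [|q qs IH] qsp; first by exists nil.
    have [|l [lS lq]] := IH; first by move=> q' q'qs; apply: qsp; right.
    have [_ [l' [l'S l'q]]] := qsp q (or_introl erefl).
    exists (l' ++ l)%SEQ; split=> [C /List.in_app_iff [/l'S|/lS]//|].
    move=> q' q'qs a [c [cg ca cl]].
    have [cl1 cl2] : (forall C, List.In C l' -> C c) /\ (forall C, List.In C l -> C c).
      by split=> C Cl; apply: cl; apply/List.in_app_iff; [left|right].
    by case: q'qs => [<-|/lq]; [apply/l'q|apply]; exists c.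
  have [al' be h h'|c [cg cl]] :=
    @extends_downset (fun be => wo_lt be al) g l _ gE lS.
    exact: wo_trans h' h.
  by exists (c al) => q /lq; apply; exists c.
exists a => l lS; have [phi [e [eP he]]] := Dform l lS.
by apply/he; apply: (aP (phi, e)); split=> //; exists l.
Qed.

(** Saturation for types in [Lam] many variables, realized one coordinate at a time. *)
Lemma saturated_family : exists c, forall C, S C -> C c.
Proof.
have [|i g g' a gg' H l lS|i g gi|g gP] := @wf_choice Lam (@wo_lt Lam) M a0
    (fun al g a => extends g al a).
- exact: wo_wf.
- have [c [cg ca cl]] := H l lS; exists c; split=> // be bi.
  by rewrite cg // gg'.
- exact: extends_exists.
exists g => C SC.
have [||//|c [cg cl]] := @extends_downset (fun _ => True) g [:: C].
- by [].
- by move=> al _; apply: gP.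
- by move=> C' [<-|[]].
by rewrite (_ : g = c); [apply: cl; left|apply: funext => al; rewrite cg].
Qed.

End SaturatedFamilies.

(** * A coherent tower of large sequences *)

Section IncreasingLists.
Variable Lam : WellOrder.
Implicit Types (s u : list Lam).

Fixpoint increasing s : Prop :=
  if s is x :: s' then (forall y, List.In y s' -> wo_lt x y) /\ increasing s' else True.

Lemma increasing_insert x s : increasing s ->
  exists s', increasing s' /\ forall y, List.In y s' <-> y = x \/ List.In y s.
Proof.
elim: s => [|z s IH] /=; first by exists [:: x]; split=> // y /=; split=> [[]|[]]; auto.
move=> [zs is_]; have [s' [is' s'P]] := IH is_.
case: (wo_total x z) => [xz|[xz|zx]].
- exists (x :: z :: s); split=> /=.
    by split=> // y [<-//|/zs]; apply: wo_trans.
  by move=> y; split=> -[e|]; auto.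
- by exists (z :: s); split=> /= [|y]; [split|split=> [|[->|]]; auto].
- exists (z :: s'); split=> /=; last by move=> y; rewrite s'P; tauto.
  by split=> // y /s'P [->|/zs].
Qed.

Lemma increasing_cover u : exists s, increasing s /\ forall x, List.In x s <-> List.In x u.
Proof.
elim: u => [|x u [s [/(increasing_insert x) [s' [is' s'P]] us]]]; first by exists nil; split.
by exists s'; split=> // y; rewrite s'P us /=; split=> -[|]; auto.
Qed.

Lemma increasing_cat s x : increasing s -> (forall y, List.In y s -> wo_lt y x) ->
  increasing (s ++ [:: x]).
Proof.
elim: s => [|y s IH] //= [ys is_] sx; split; last by apply: IH => // z zs; apply: sx; right.
by move=> z /List.in_app_iff [/ys //|[<-|[]]]; apply: sx; left.
Qed.

End IncreasingLists.

Section Tower.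
Variables (L : Lang) (M : Structure L) (K Lam : WellOrder).
Local Notation "a ≺ b" := (@ltM L M a b) (at level 70).
Hypothesis lt_irr : forall a : M, ~ a ≺ a.
Hypothesis lt_trans : forall a b c : M, a ≺ b -> b ≺ c -> a ≺ c.
Hypothesis lt_total : forall a b : M, a ≺ b \/ a = b \/ b ≺ a.
Hypothesis scheme : forall (n m : nat) (phi : form L), form_fv_lt (n + m) phi ->
  forall z0 : M, exists z1 : M, z0 ≺ z1 /\
    forall y0 : nat -> M, exists y1 : nat -> M,
      (forall i, (i < n)%N -> y1 i ≺ z1) /\
      forall t : nat -> M, (forall j, (j < m)%N -> t j ≺ z0) ->
        (sat (tup_env n y0 t) phi <-> sat (tup_env n y1 t) phi).
Implicit Types (s u : list Lam) (R : (Lam + nat -> M) -> Prop) (c d b : Lam -> M).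

(** The quantifier over a variable missing from [s'] is dropped by picking any witness. [F] collects
    the variables kept so far, on which the two assignments agree. *)
Lemma Qs_weaken_on (F : Lam -> Prop) s s' (C : (Lam -> M) -> Prop) b b' :
  increasing s -> increasing s' -> (forall x, List.In x s' -> List.In x s) ->
  (forall r r', (forall x, List.In x s' \/ F x -> r x = r' x) -> C r -> C r') ->
  (forall x, F x -> b x = b' x) -> (forall x, List.In x s -> ~ F x) ->
  Qs s C b -> Qs s' C b'.
Proof.
elim: s s' F b b' => [|x s IH] s' F b b' /=.
  case: s' => [|y s'] _ _ ss' CF bb' _; first by apply: CF => x [[]|/bb'].
  by case: (ss' y); left.
move=> [xs is_] is' ss' CF bb' sF H.
case: s' is' ss' CF => [|y s'] is' ss' CF.
  have [a [_ Ha]] := H (inh M); apply: (IH [::] F _ _ _ _ _ _ _ _ Ha) => //.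
    move=> z Fz; rewrite upd_neq ?bb' // => zx.
    by apply: (sF x); [left|rewrite -zx].
  by move=> z zs; apply: sF; right.
have [yx|yx] := pselect (y = x).
  subst y => w; have [a [wa Ha]] := H w; exists a; split=> //.
  case: is' => ys' is'.
  have xs' z : List.In z s' -> z <> x.
    by move=> /ys' yz zx; apply: (@wo_irr _ x); rewrite -{2}zx.
  apply: (IH s' (fun z => F z \/ z = x) _ _ _ _ _ _ _ _ Ha) => //.
  - move=> z zs'; case: (ss' z) => //=; first by right.
    by move=> xz; case: (xs' z zs').
  - by move=> r r' rr'; apply: CF => z [[e|zs']|Fz]; apply: rr'; auto.
  - move=> z [Fz|->]; last by rewrite !upd_eq.
    have zx : z <> x by move=> e; apply: (sF x); [left|rewrite -e].
    by rewrite !upd_neq ?bb'.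
  - move=> z zs [|zx]; first by apply: sF; right.
    by apply: (@wo_irr _ x); apply: xs; rewrite -{1}zx.
have [a [_ Ha]] := H (inh M); apply: (IH (y :: s') F _ _ _ _ _ _ _ _ Ha) => //.
- have ys : List.In y s by case: (ss' y) => [|/esym //|//]; left.
  move=> z zs'; case: (ss' z zs') => // xz.
  case: zs' => [yz|zs']; first by case: yx; rewrite yz.
  case: (@wo_irr _ x); apply: wo_trans (xs _ ys) _; rewrite xz.
  by case: is' => + _; apply.
- move=> z Fz; rewrite upd_neq ?bb' // => zx.
  by apply: (sF x); [left|rewrite -zx].
- by move=> z zs; apply: sF; right.
Qed.

Lemma Qs_weaken s s' (C : (Lam -> M) -> Prop) b b' :
  increasing s -> increasing s' -> (forall x, List.In x s' -> List.In x s) ->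
  (forall r r', (forall x, List.In x s' -> r x = r' x) -> C r -> C r') ->
  Qs s C b -> Qs s' C b'.
Proof.
move=> is_ is' ss' CF; apply: (@Qs_weaken_on (fun _ => False) s s' C b b') => //.
  by move=> r r' rr'; apply: CF => x xs'; apply: rr'; left.
by move=> x _ [].
Qed.

Definition supported s R : Prop := forall r r' : Lam + nat -> M,
  (forall x, List.In x s -> r (inl x) = r' (inl x)) ->
  (forall k, r (inr k) = r' (inr k)) -> (R r <-> R r').

Lemma supported_mono s s' R : (forall x, List.In x s -> List.In x s') ->
  supported s R -> supported s' R.
Proof. by move=> ss' sR r r' rr'; apply: sR => x /ss' /rr'. Qed.

Lemma supportedE R : definable (@none _ M) R -> exists s, increasing s /\ supported s R.
Proof.
move=> /definable_finsupp [s0 s0P].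
have [s [is_ sP]] := increasing_cover (pmap (fun v => if v is inl x then Some x else None) s0).
exists s; split=> // r r' rl rr; apply: s0P => -[x|k] // xs0; apply: rl; apply/sP.
exact: In_pmap xs0.
Qed.

Lemma agree_supported s R m c c' d d' : supported s R ->
  (forall x, List.In x s -> c x = c' x) -> (forall x, List.In x s -> d x = d' x) ->
  agree R m c d -> agree R m c' d'.
Proof.
move=> sR cc' dd' H t mt.
have Ec : R (join c t) <-> R (join c' t) by apply: sR.
have Ed : R (join d t) <-> R (join d' t) by apply: sR.
by rewrite -Ec -Ed; apply: H.
Qed.

(* Strictly increasing index lists suffice, and the order matters: later
   entries are chosen unboundedly far above the earlier ones. *)
Definition large m c : Prop := forall s l b, increasing s ->
  (forall R, List.In R l -> definable (@none _ M) R /\ supported s R) ->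
  Qs s (fun x => forall R, List.In R l -> agree R m x c) b.

Lemma Qs_agree_weaken s s' l m c b b' : increasing s -> increasing s' ->
  (forall x, List.In x s' -> List.In x s) -> (forall R, List.In R l -> supported s' R) ->
  Qs s (fun x => forall R, List.In R l -> agree R m x c) b ->
  Qs s' (fun x => forall R, List.In R l -> agree R m x c) b'.
Proof.
move=> is_ is' ss' sl; apply: Qs_weaken => // r r' rr' H R Rl.
by apply: (agree_supported (sl R Rl) rr' _ (H R Rl)).
Qed.

Hypothesis Kreg : regular_cardinal K.
Hypothesis Laminf : infinite_type Lam.
Hypothesis LamK : card_lt Lam K.
Hypothesis Msat : kappa_saturated K M.
Variable m : K -> M.
Hypothesis m_incr : forall i j, wo_lt i j -> m i ≺ m j.

Definition good (i : K) (g : K -> Lam -> M) c : Prop :=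
  (forall j R, wo_lt j i -> definable (@none _ M) R -> agree R (m j) c (g j)) /\
  large (m i) c.

(** Coherence with the earlier sequences and largeness together form a type over fewer than [K]
    parameters. For a finite part of it, the latest stage involved supplies a large condition
    implying the coherence required, and [Qs_refine] finds under this condition a [c] whose own type
    up to [m i] is as large as that finite part asks. *)
Lemma good_exists (i : K) (g : K -> Lam -> M) :
  (forall j, wo_lt j i -> good j g (g j)) -> exists c, good i g c.
Proof.
move=> gg.
(* The parameters are the bounds up to and including [m i] and the entries of all earlier
   sequences. *)
pose P1 a := exists j, ~ wo_lt i j /\ m j = a.
pose P2 a := exists j al, wo_lt j i /\ g j al = a.
pose P a := P1 a \/ P2 a.
have PK : card_lt {a | P a} K.
  apply: (card_lt_union Laminf LamK).
    apply: card_lt_le_trans (cardinal_seg_le_lt Kreg i).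
    apply: (@card_le_image _ _ (fun j => m (sval j))) => a [j [ij e]].
    by exists (exist _ j ij).
  apply: card_lt_le_trans (card_lt_prod Laminf (cardinal_seg_lt Kreg i) LamK).
  apply: (@card_le_image _ _ (fun p => g (sval p.1) p.2)) => a [j [al [ji e]]].
  by exists (exist _ j ji, al).
have Pmi : P (m i) by left; exists i; split=> //; apply: wo_irr.
have Pmj j : wo_lt j i -> P (m j).
  by move=> ji; left; exists j; split=> // ij; apply: (wo_irr (wo_trans ij ji)).
pose S1 (C : (Lam -> M) -> Prop) := exists j R,
  [/\ wo_lt j i, definable (@none _ M) R & C = fun c => agree R (m j) c (g j)].
(* The starting assignment is the constant [m i], an allowed parameter. Any other one gives an
   equivalent condition, since the list [s] binds all relevant variables. *)
pose S2 (C : (Lam -> M) -> Prop) := exists s l, [/\ increasing s,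
  forall R, List.In R l -> definable (@none _ M) R /\ supported s R
  & C = fun c => Qs s (fun x => forall R, List.In R l -> agree R (m i) x c) (fun _ => m i)].
have v0P X : allowed P (inr (m i) : X + M) by [].
have Sdef C : S1 C \/ S2 C -> definable P C.
  case=> [[j [R [ji dR ->]]]|[s [l [is_ dl ->]]]].
    have dE := definable_agree lt_irr dR (Pmj j ji).
    have fP v : allowed P (join inl (inr \o g j) v : Lam + M).
      by case: v => //= al; right; exists j, al.
    apply: definable_ext (definable_sub fP dE) => c.
    suff -> : (fun v => pval c (join inl (inr \o g j) v)) = join c (g j) by [].
    by apply: funext => -[].
  pose F (r : Lam + Lam -> M) := forall R, List.In R l -> agree R (m i) (r \o inl) (r \o inr).
  have dF : definable P F.
    apply: (definable_list_all (v0P _)) => R Rl.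
    by apply: definable_agree => //; case: (dl R Rl).
  have dQ := definable_Qs (map inl s) dF.
  have fP (v : Lam + Lam) : allowed P (join (fun _ => inr (m i)) inl v : Lam + M) by case: v.
  apply: definable_ext (definable_sub fP dQ) => c.
  rewrite (_ : (fun v => pval c _) = join (fun _ => m i) c); last by apply: funext => -[].
  exact: Qs_inl.
have Ssat l0 : (forall C, List.In C l0 -> S1 C \/ S2 C) ->
    exists c, forall C, List.In C l0 -> C c.
  move=> l0S.
  (* Normal form of a finite part: one increasing list [s] supporting everything, a list [J] of
     coherence conditions and a list [l] of relations for largeness. *)
  have [s [J [l [is_ Jok lok impl]]]] : exists s (J : list (K * ((Lam + nat -> M) -> Prop))) l,
    [/\ increasing s, forall q, List.In q J ->
          [/\ wo_lt q.1 i, definable (@none _ M) q.2 & supported s q.2],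
        forall R, List.In R l -> definable (@none _ M) R /\ supported s R
      & forall c, (forall q, List.In q J -> agree q.2 (m q.1) c (g q.1)) ->
          Qs s (fun x => forall R, List.In R l -> agree R (m i) x c) (fun _ => m i) ->
          forall C, List.In C l0 -> C c].
    elim: l0 l0S => [|C l0 IH] l0S; first by exists nil, nil, nil; split.
    have [|s [J [l [is_ Jok lok impl]]]] := IH; first by move=> D Dl; apply: l0S; right.
    case: (l0S C (or_introl erefl)) => [[j [R [ji dR CE]]]|[s1 [l1 [is1 l1ok CE]]]].
      have [s1 [is1 s1R]] := supportedE dR.
      have [s2 [is2 s2P]] := increasing_cover (s ++ s1)%SEQ.
      have ss2 x : List.In x s -> List.In x s2 by move=> xs; apply/s2P/List.in_app_iff; left.
      have s1s2 x : List.In x s1 -> List.In x s2 by move=> xs; apply/s2P/List.in_app_iff; right.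
      exists s2, ((j, R) :: J), l; split=> //.
      - move=> q [<-|/Jok [? ? ?]]; split=> //; first exact: supported_mono s1R.
        by apply: supported_mono ss2 _.
      - by move=> R' /lok [? ?]; split=> //; apply: supported_mono ss2 _.
      - move=> c cJ cl C' [<-|]; first by rewrite CE; apply: (cJ (j, R)); left.
        apply: impl => [q qJ|]; first by apply: cJ; right.
        by apply: Qs_agree_weaken cl => // R' /lok [].
    have [s2 [is2 s2P]] := increasing_cover (s ++ s1)%SEQ.
    have ss2 x : List.In x s -> List.In x s2 by move=> xs; apply/s2P/List.in_app_iff; left.
    have s1s2 x : List.In x s1 -> List.In x s2 by move=> xs; apply/s2P/List.in_app_iff; right.
    exists s2, J, (l ++ l1)%SEQ; split=> //.
    - by move=> q /Jok [? ? ?]; split=> //; apply: supported_mono ss2 _.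
    - move=> R /List.in_app_iff [/lok|/l1ok] [? ?]; split=> //.
        by apply: supported_mono ss2 _.
      by apply: supported_mono s1s2 _.
    - move=> c cJ cl.
      have {cl} [cl cl1] :
          Qs s2 (fun x => forall R, List.In R l -> agree R (m i) x c) (fun _ => m i) /\
          Qs s2 (fun x => forall R, List.In R l1 -> agree R (m i) x c) (fun _ => m i).
        by split; apply: Qs_mono cl => x H R Rl; apply: H; apply/List.in_app_iff; [left|right].
      move=> C' [<-|]; last by apply: impl => //; apply: Qs_agree_weaken cl => // R /lok [].
      by rewrite CE; apply: Qs_agree_weaken cl1 => // R /l1ok [].
  pose C x := forall q, List.In q J -> agree q.2 (m q.1) x (g q.1).
  have dC : definable (@any _ M) C.
    apply: (@definable_list_all _ _ _ _ (inr (m i))) => // q /Jok [qi dq _].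
    apply: (@definable_mono _ _ _ P) => //.
    by apply: Sdef; left; exists q.1, q.2.
  have QC : Qs s C (fun _ => m i).
    (* [x] is the latest stage mentioned in [J]. Largeness of [g x] gives unboundedly many tuples
       with its type up to [m x], and [g x] itself coheres with the stages before. If [J] is empty,
       it is enough that [M] has no last element. *)
    have [nJ|[x [xi xJ]]] := wo_list_max (fun j => wo_lt j i) (map fst J).
      have nilJ q : ~ List.In q J.
        by move=> qJ; apply: (nJ q.1); [apply/In_map; exists q|case: (Jok q qJ)].
      by apply: Qs_mono (Qs_True scheme s _) => x _ q /nilJ.
    have [cohx largex] := gg x xi.
    have Jdef R : List.In R (map snd J) -> definable (@none _ M) R /\ supported s R.
      by move=> /In_map [q [<- /Jok []]].
    apply: Qs_mono (largex s (map snd J) (fun _ => m i) is_ Jdef) => y yJ q qJ.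
    have [qi dq _] := Jok q qJ.
    have nxq : ~ wo_lt x q.1 by apply: xJ => //; apply/In_map; exists q.
    have mq : ~ m x ≺ m q.1.
      case: (wo_nltNgt nxq) => [<-|/m_incr]; first exact: lt_irr.
      exact: (lt_nlt lt_irr lt_trans).
    have a1 : agree q.2 (m q.1) y (g x).
      by apply: (agree_le lt_trans lt_total mq); apply: yJ; apply/In_map; exists q.
    case: (wo_nltNgt nxq) => [e|qx]; first by rewrite -e in a1 *.
    exact: agree_trans a1 (cohx _ _ qx dq).
  have ldef R : List.In R l -> definable (@none _ M) R by move=> /lok [].
  have [c [Cc Qc]] := Qs_refine lt_irr lt_trans lt_total scheme (m i) ldef dC QC.
  exists c; apply: impl => //; apply: Qs_mono Qc => x [_ H]; exact: H.
have [c cS] := saturated_family Msat Laminf LamK PK Pmi Sdef Ssat.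
exists c; split=> [j R ji dR|s l b is_ lok].
  by apply: (cS (fun c => agree R (m j) c (g j))); left; exists j, R.
have := cS (fun c => Qs s (fun x => forall R, List.In R l -> agree R (m i) x c) (fun _ => m i)).
move=> H; apply: Qs_agree_weaken (H _) => //; first by move=> R /lok [].
by right; exists s, l.
Qed.

Lemma tower_exists : exists g : K -> Lam -> M, forall i, good i g (g i).
Proof.
have [|i g g' c gg' [H1 H2]|i g gg|g gP] := @wf_choice K (@wo_lt K) (Lam -> M)
  (fun _ => inh M) (fun i g c => good i g c).
- exact: wo_wf.
- by split=> // j R ji dR; rewrite -gg' //; apply: H1.
- exact: good_exists.
- by exists g.
Qed.

End Tower.

(** * The limit structure *)

Section Hull.
Variables (L : Lang) (M : Structure L) (Lam : WellOrder).
Implicit Types (r : Lam -> M).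

(** Terms with parameters from [M] and generators indexed by [Lam]; the elements of the limit
    structure are classes of such terms. *)
Inductive hull : Type :=
| hpar : M -> hull
| hgen : Lam -> hull
| happ : forall f : Func L, ('I_(fun_ar f) -> hull) -> hull.

Fixpoint heval r (h : hull) : M :=
  match h with
  | hpar a => a
  | hgen al => r al
  | happ f args => fun_i (fun i => heval r (args i))
  end.

Fixpoint hsubst (eta : nat -> hull) (t : term L) : hull :=
  match t with
  | tvar k => eta k
  | tapp f args => happ (fun i => hsubst eta (args i))
  end.

Lemma heval_subst r eta t : heval r (hsubst eta t) = eval (fun k => heval r (eta k)) t.
Proof. by elim: t => //= f args IH; congr fun_i; apply: funext. Qed.

Lemma definable_heval h : definable_fun (fun r => heval r h).
Proof.
elim: h => [a|al|f args IH].
- exact: (@definable_fun_val _ M _ (inr a)).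
- exact: (@definable_fun_val _ M _ (inl al)).
(* [definable_fun_eval] takes a sequence of functions, so the finitely many arguments are padded
   with a constant. *)
pose F k (r : Lam -> M) := oapp (fun i => heval r (args i)) (inh M) (insub k).
have dF k : definable_fun (F k).
  rewrite /F; case: insub => [i|] /=; first exact: IH.
  exact: (@definable_fun_val _ M _ (inr (inh M))).
have [t [e te]] := definable_fun_eval (tapp (fun i : 'I_(fun_ar f) => tvar L i)) dF.
exists t, e => r; rewrite -te /=; congr fun_i; apply: funext => i.
by rewrite /F valK.
Qed.

(** The graph of a term, [None] being the place of its value. It is stated as a predicate because
    finite support and coherence are available for predicates. *)
Lemma definable_heval_eq h :
  definable (@any _ M) (fun r : option Lam -> M => heval (r \o Some) h = r None).
Proof.
pose F k (r : option Lam -> M) := if k is 0 then heval (r \o Some) h else r None.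
have dF k : definable_fun (F k).
  case: k => [|k] /=; last exact: (@definable_fun_val _ M _ (inl None)).
  have [t [e te]] := definable_heval h.
  exists t, (fun k => match e k with inl al => inl (Some al) | inr a => inr a end) => r.
  rewrite /F te; congr eval; apply: funext => k /=.
  by case: (e k).
have := definable_sat (fEq (tvar L 0) (tvar L 1)) dF.
by apply: definable_ext.
Qed.

Lemma heval_finsupp h : exists s : list Lam, forall r r',
  (forall x, List.In x s -> r x = r' x) -> heval r h = heval r' h.
Proof.
have [s sP] := definable_finsupp (definable_heval_eq h).
exists (pmap id s) => r r' rr'.
pose q (c : Lam -> M) (x : option Lam) := if x is Some al then c al else heval r h.
have qq' x : List.In x s -> q r x = q r' x.
  by case: x => [al|] //= als; apply: rr'; apply: In_pmap als.
by have /= /(_ erefl) /esym := (sP (q r) (q r') qq').1.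
Qed.

End Hull.

Section Coding.
Variables (L : Lang) (M : Structure L) (Lam : WellOrder).
Hypothesis Minf : infinite_type M.
Hypothesis LamM : card_le Lam M.
Hypothesis Lcount : exists f : Func L -> nat, injective f.

Lemma hull_card_le : card_le (hull M Lam) M.
Proof.
have [u ui] := Minf; have [v vi] := LamM; have [ef efi] := Lcount.
have [p pi] := Hessenberg Minf.
(* Injectivity of [lc] is shown for lists of equal length. This suffices, as the coded function
   symbol fixes the arity. *)
pose lc := fix lc (s : seq M) := if s is x :: s' then p (x, lc s') else u 0.
have lci s s' : size s = size s' -> lc s = lc s' -> s = s'.
  elim: s s' => [|x s IH] [|y s'] //= [/IH H] /pi [-> e].
  by congr cons; apply: H.
pose code := fix code (h : hull M Lam) : M := match h with
  | hpar a => p (u 0, a)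
  | hgen al => p (u 1, v al)
  | happ f args => p (u 2, p (u (ef f), lc (map (fun i => code (args i)) (enum 'I_(fun_ar f)))))
  end.
exists code; elim=> [a|al|f args IH] [b|be|f' args'] //= /pi []
  => [->//|/ui//|/ui//|/ui//|/vi -> //|/ui//|/ui//|/ui//|].
move=> /pi [/ui/efi ff']; case: f' / ff' args' => args' /lci.
rewrite !size_map => /(_ erefl) /eq_in_map e.
congr happ; apply: funext => i; apply: IH.
by apply: e; rewrite mem_enum.
Qed.

End Coding.

(** * The term model along the tower, modulo eventual equality *)

Section Limit.
Variables (L : Lang) (M : Structure L) (K Lam : WellOrder).
Local Notation "a ≺ b" := (@ltM L M a b) (at level 70).
Hypothesis lt_irr : forall a : M, ~ a ≺ a.
Hypothesis lt_trans : forall a b c : M, a ≺ b -> b ≺ c -> a ≺ c.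
Hypothesis lt_total : forall a b : M, a ≺ b \/ a = b \/ b ≺ a.
Hypothesis skolem : forall theta : form L, exists tau : term L, forall e : nat -> M,
  (exists a : M, sat (scons a e) theta) -> sat (scons (eval e tau) e) theta.
Hypothesis Kreg : regular_cardinal K.
Hypothesis Lamreg : regular_cardinal Lam.
Variables (m : K -> M) (g : K -> Lam -> M).
Hypothesis m_incr : forall i j, wo_lt i j -> m i ≺ m j.
Hypothesis m_cofinal : forall a, exists i, ~ m i ≺ a.
Hypothesis g_coherent : forall i j R, wo_lt j i ->
  definable (@none _ M) R -> agree R (m j) (g i) (g j).
Hypothesis g_large : forall i, large (m i) (g i).

Local Notation hull := (hull M Lam).
Local Notation ev P := (exists i0 : K, forall i, wo_lt i0 i -> P i).

Lemma ev_and (P Q : K -> Prop) : ev P -> ev Q -> ev (fun i => P i /\ Q i).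
Proof.
move=> [i iP] [j jQ]; have [k kP] := regular_above Kreg [:: i; j].
have ik := kP i (or_introl erefl); have jk := kP j (or_intror (or_introl erefl)).
by exists k => x kx; split; [apply/iP/wo_trans/kx|apply/jQ/wo_trans/kx].
Qed.

Lemma ev_mono (P Q : K -> Prop) : (forall i, P i -> Q i) -> ev P -> ev Q.
Proof. by move=> PQ [i iP]; exists i => j /iP /PQ. Qed.

Lemma ev_all (P : K -> Prop) : (forall i, P i) -> ev P.
Proof. by move=> allP; have [_ [[u _] _]] := Kreg; exists (u 0). Qed.

Lemma ev_ex (P : K -> Prop) : ev P -> exists i, P i.
Proof. by move=> [i iP]; have [j ij] := regular_no_max Kreg i; exists j; apply: iP. Qed.

Lemma ev_ord n (P : 'I_n -> K -> Prop) :
  (forall k, ev (P k)) -> ev (fun i => forall k, P k i).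
Proof.
move=> /choice [f fP]; have [j jP] := regular_above Kreg (map f (enum 'I_n)).
exists j => i ji k; apply: fP; apply: wo_trans ji; apply: jP.
by apply/In_map; exists k; split=> //; apply: mem_In; rewrite mem_enum.
Qed.

Definition upto (j : K) (a : M) : Prop := ~ m j ≺ a.

Lemma upto_le j j' a : ~ wo_lt j' j -> upto j a -> upto j' a.
Proof.
move=> /wo_nltNgt [<-//|/m_incr jj'] ja j'a.
by apply: ja; apply: lt_trans j'a.
Qed.

(** Only finitely many parameters occur, and the [m j] are cofinal. *)
Lemma definable_upto (X : Type) (x0 : X) (C : (X -> M) -> Prop) a :
  definable (@any _ M) C -> exists j, definable (upto j) C /\ upto j a.
Proof.
move=> /(definable_finparam x0) [s sP].
have [z zP] : exists z, forall b, List.In b (a :: s) -> ~ z ≺ b.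
  elim: (a :: s) => [|b l [z zP]]; first by exists a.
  case: (lt_total z b) => [zb|bz].
    exists b => y [->|/zP zy]; first exact: lt_irr.
    by move=> by_; apply: zy; apply: lt_trans by_.
  exists z => y [<-|/zP //]; case: bz => [->|bz]; first exact: lt_irr.
  exact: (lt_nlt lt_irr lt_trans).
have [j jz] := m_cofinal z.
have up b : List.In b (a :: s) -> upto j b.
  by move=> /zP zb; apply: (nlt_trans lt_trans lt_total zb jz).
by exists j; split; [apply: sP => b bs|]; apply: up; [right|left].
Qed.

(** Separates the parameters from a definition, to bring it into the form that [agree] handles. *)
Lemma definable_split (P : M -> Prop) (p0 : M) (C : (Lam -> M) -> Prop) : P p0 ->
  definable P C -> exists R (t : nat -> M), [/\ definable (@none _ M) R,
    forall k, P (t k) & forall c, C c <-> R (join c t)].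
Proof.
move=> Pp0 [p [e [eP h]]].
pose e0 k : (Lam + nat) + M := if e k is inl al then inl (inl al) else inl (inr k).
pose t k := if e k is inr a then a else p0.
exists (fun q => sat (pval q \o e0) p), t.
split=> [|k|c].
- by exists p, e0; split=> // k; rewrite /e0; case: (e k).
- by rewrite /t; move: (eP k); case: (e k).
rewrite h (_ : pval c \o e = pval (join c t) \o e0) //.
by apply: funext => k /=; rewrite /e0 /t; case E: (e k) => //=; rewrite E.
Qed.

Lemma coherent (C : (Lam -> M) -> Prop) i j : wo_lt j i -> definable (upto j) C ->
  (C (g i) <-> C (g j)).
Proof.
move=> ji /(definable_split (@lt_irr (m j) : upto j (m j))) [R [t [dR tP CR]]].
by rewrite !CR; apply: (g_coherent ji dR).
Qed.

Let al0 : Lam := projT1 (cid (Lamreg.2.1)) 0.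

(** A property with parameters up to [m j] has a constant truth value along the tower from [j] on.
    The final segments of [K] thus act as an ultrafilter on definable properties, as the theorem of
    Los requires. *)
Lemma decided (C : (Lam -> M) -> Prop) : definable (@any _ M) C ->
  ev (fun i => C (g i)) \/ ev (fun i => ~ C (g i)).
Proof.
move=> /(definable_upto al0 (inh M)) [j [dC _]].
have [Cj|nCj] := pselect (C (g j)); [left|right]; exists j => i ji.
  exact/(coherent ji dC).
by move/(coherent ji dC).
Qed.

Lemma definable_sat_hull (p : form L) (eta : nat -> hull) :
  definable (@any _ M) (fun c => sat (fun k => heval c (eta k)) p).
Proof.
apply: (definable_sat p (F := fun k c => heval c (eta k))) => k.
exact: definable_heval.
Qed.

Definition heq (h h' : hull) : Prop := ev (fun i => heval (g i) h = heval (g i) h').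

(** The choice depends only on the predicate [heq h], so equivalent terms have the same
    representative, and the quotient can be taken as the set of fixed points of [hrep]. *)
Definition hrep (h : hull) : hull := some_such (hpar Lam (inh M)) (heq h).

Lemma hrepP h : heq h (hrep h).
Proof. by apply: some_suchP; exists h; apply: ev_all. Qed.

Lemma hrepE h h' : hrep h = hrep h' <-> heq h h'.
Proof.
split=> [e|hh'].
  have := hrepP h; rewrite e => H; apply: ev_mono (ev_and H (hrepP h')) => i [-> ->//].
congr some_such; apply: funext => x; apply: propext; split=> hx.
  by apply: ev_mono (ev_and hh' hx) => i [<-].
by apply: ev_mono (ev_and hh' hx) => i [->].
Qed.

Lemma hrepK h : hrep (hrep h) = hrep h.
Proof. by apply/hrepE; apply: ev_mono (hrepP h) => i /esym. Qed.

Definition limit_car : Type := {h : hull | hrep h = h}.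

Definition hclass (h : hull) : limit_car := exist _ (hrep h) (hrepK h).

Definition limit : Structure L := {|
  car := limit_car;
  inh := hclass (hpar Lam (inh M));
  fun_i f args := hclass (happ (fun i => sval (args i)));
  rel_i R args := ev (fun i => rel_i (fun k => heval (g i) (sval (args k))))
|}.

Lemma hclass_val (b : limit) : hclass (sval b) = b.
Proof. by case: b => h hh; apply: eq_exist. Qed.

Lemma hclassE h h' : hclass h = hclass h' <-> heq h h'.
Proof.
split=> [e|hh']; first by apply/hrepE; apply: (congr1 sval e).
by apply: eq_exist; apply/hrepE.
Qed.

Lemma val_hclass h : ev (fun i => heval (g i) (sval (hclass h)) = heval (g i) h).
Proof. by apply: ev_mono (hrepP h) => i /esym. Qed.

Lemma limit_lt (x y : limit) :
  ltM x y <-> ev (fun i => heval (g i) (sval x) ≺ heval (g i) (sval y)).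
Proof.
rewrite /ltM /=; suff E i : (fun k : 'I_(rel_ar (lt_sym L)) =>
    heval (g i) (sval (if val k == 0 then x else y))) =
  (fun k => if val k == 0 then heval (g i) (sval x) else heval (g i) (sval y)).
  by split; apply: ev_mono => i; rewrite E.
by apply: funext => k; case: ifP.
Qed.

Lemma limit_eval (e : nat -> limit) t :
  ev (fun i => heval (g i) (sval (eval e t)) = eval (fun k => heval (g i) (sval (e k))) t).
Proof.
elim: t => [k|f args IH]; first exact: ev_all.
have Hf := val_hclass (happ (fun i => sval (eval e (args i)))).
apply: ev_mono (ev_and Hf (ev_ord IH)) => i [-> H] /=.
by congr fun_i; apply: funext.
Qed.

(** The theorem of Los for eventual truth: [decided] handles implication, and Skolem terms handle
    the universal quantifier. *)
Theorem limit_Los (p : form L) (e : nat -> limit) :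
  sat e p <-> ev (fun i => sat (fun k => heval (g i) (sval (e k))) p).
Proof.
elim: p e => [t1 t2|R args||p1 IH1 p2 IH2|p IH] e.
- have H := ev_and (limit_eval e t1) (limit_eval e t2).
  rewrite /= -[eval e t1]hclass_val -[eval e t2]hclass_val hclassE.
  by split=> H'; apply: ev_mono (ev_and H H') => i [[h1 h2]]; rewrite -?h1 -?h2 // h1 h2.
- have H := ev_ord (fun k => limit_eval e (args k)).
  have E i : (forall k, heval (g i) (sval (eval e (args k))) =
      eval (fun k => heval (g i) (sval (e k))) (args k)) ->
    (fun k => heval (g i) (sval (eval e (args k)))) =
    (fun k => eval (fun k => heval (g i) (sval (e k))) (args k)).
    by move=> h; apply: funext.
  by split=> H'; apply: ev_mono (ev_and H H') => i [/E h]; rewrite /= h.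
- by split=> // /ev_ex [].
- rewrite /= IH1 IH2; split=> [H|H H1].
    have [H1|nH1] := decided (definable_sat_hull p1 (fun k => sval (e k))).
      by apply: ev_mono (H H1) => i.
    by apply: ev_mono nH1 => i n /n.
  by apply: ev_mono (ev_and H H1) => i [h]; apply: h.
have sconsE i (a : limit) : (fun k => heval (g i) (sval (scons a e k))) =
    scons (heval (g i) (sval a)) (fun k => heval (g i) (sval (e k))).
  by apply: funext => -[|k].
split=> /= [H|H a]; last first.
  by apply/IH; apply: ev_mono H => i /(_ (heval (g i) (sval a))); rewrite sconsE.
have [//|nall] := decided (definable_sat_hull (fAll p) (fun k => sval (e k))).
(* A Skolem term for the negation turns an eventual failure of the universal statement into a single
   element of the limit that contradicts the hypothesis. *)
have [tau tauP] := skolem (fNeg p).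
pose h := hsubst (fun k => sval (e k)) tau.
have Hh := (IH _).1 (H (hclass h)).
have [i [[nalli hi] Hhi]] := ev_ex (ev_and (ev_and nall (val_hclass h)) Hh).
case: (tauP (fun k => heval (g i) (sval (e k)))).
  by have /existsNP [a na] := nalli; exists a.
by move: Hhi; rewrite sconsE hi heval_subst.
Qed.

Definition limit_embed (a : M) : limit := hclass (hpar Lam a).

Lemma limit_embed_elementary : elementary_embedding limit_embed.
Proof.
move=> p e; rewrite limit_Los; have [N fvN] := form_fvE p.
have H : ev (fun i => forall k : 'I_N, heval (g i) (sval (limit_embed (e k))) = e k).
  by apply: ev_ord => k; apply: val_hclass.
have E i : (forall k : 'I_N, heval (g i) (sval (limit_embed (e k))) = e k) ->
    sat (fun k => heval (g i) (sval (limit_embed (e k)))) p = sat e p.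
  by move=> Hi; apply: (sat_fv fvN) => k kN; apply: (Hi (Ordinal kN)).
split=> [pe|/(ev_and H) /ev_ex [i [/E <-]] //].
by apply: ev_mono H => i /E ->.
Qed.

Lemma limit_end (b : limit) (a : M) : ltM b (limit_embed a) ->
  exists a', limit_embed a' = b.
Proof.
move=> /limit_lt ba; set h := sval b in ba.
have {}ba : ev (fun i => heval (g i) h ≺ a).
  by apply: ev_mono (ev_and ba (val_hclass (hpar Lam a))) => i [+ e]; rewrite e.
have [j [dG ja]] := definable_upto None a (definable_heval_eq h).
have [i [bi ji]] := ev_ex (ev_and ba (ex_intro _ j (fun i (ji : wo_lt j i) => ji))).
set d := heval (g i) h in bi.
(* Since [d] is below [a], it lies in the segment up to [m i]. Then [heval c h = d] has all its
   parameters in the segment over which later sequences have the type of [g i], so it persists. *)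
have id_ : upto i d.
  move=> mid; apply: (upto_le _ ja) (lt_trans mid bi).
  by move=> ij; apply: (wo_irr (wo_trans ij ji)).
have dGi : definable (upto i) (fun r : option Lam -> M => heval (r \o Some) h = r None).
  apply: definable_mono dG => x; apply: upto_le => ij; exact: (wo_irr (wo_trans ij ji)).
pose f (x : option Lam) : Lam + M := if x is Some al then inl al else inr d.
have fP x : allowed (upto i) (f x) by case: x.
have dC : definable (upto i) (fun c : Lam -> M => heval c h = d).
  exact: definable_ext (definable_sub fP dGi).
exists d; rewrite -[b]hclass_val; apply/hclassE; exists i => i' ii'.
by symmetry; apply/(coherent ii' dC).
Qed.

Lemma Qs_cat (s s' : list Lam) (C : (Lam -> M) -> Prop) b :
  Qs (s ++ s') C b <-> Qs s (Qs s' C) b.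
Proof.
elim: s b => [|x s IH] b //=.
by split=> H w; have [a [wa Ha]] := H w; exists a; split=> //; apply/IH.
Qed.

(** Otherwise the failure holds eventually and, by largeness, for unboundedly many choices along an
    increasing list ending in [be]. The value of [h] is settled before the last choice, so the entry
    at [be] can be taken above it, a contradiction. *)
Lemma gen_above (h : hull) (s : list Lam) be :
  (forall r r', (forall x, List.In x s -> r x = r' x) -> heval r h = heval r' h) ->
  (forall x, List.In x s -> wo_lt x be) ->
  ev (fun i => heval (g i) h ≺ g i be).
Proof.
move=> hs sbe; pose C c := ~ heval c h ≺ c be.
have dC : definable (@any _ M) C.
  apply: (@definable_not _ _ _ _ (inl be)) => //.
  have := definable_sat_hull (lt_form L) (fun k => if k is 0 then h else hgen M be).
  by apply: definable_ext => c; rewrite sat_lt_form.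
have [evC|evnC] := decided dC; last by apply: ev_mono evnC => i /contrapT.
exfalso; have [j [dCj _]] := definable_upto al0 (inh M) dC.
have [i [Ci ji]] := ev_ex (ev_and evC (ex_intro _ j (fun i (ji : wo_lt j i) => ji))).
have {}dC : definable (upto i) C.
  apply: definable_mono dCj => x; apply: upto_le => ij; exact: (wo_irr (wo_trans ij ji)).
have [R [t [dR tP CR]]] := definable_split (@lt_irr (m i) : upto i (m i)) dC.
have [s0 [_ Rs0]] := supportedE dR.
have [s1 [is1 s1P]] := increasing_cover s.
have is1' : increasing (s1 ++ [:: be]).
  by apply: increasing_cat => // x /s1P /sbe.
have [s2 [is2 s2P]] := increasing_cover (s0 ++ (s1 ++ [:: be]))%SEQ.
have Q2 : Qs s2 C (fun _ => m i).
  have lR R' : List.In R' [:: R] -> definable (@none _ M) R' /\ supported s2 R'.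
    move=> [<-|[]]; split=> //; apply: supported_mono Rs0 => x xs0.
    by apply/s2P/List.in_app_iff; left.
  apply: Qs_mono (@g_large i s2 [:: R] (fun _ => m i) is2 lR) => x agx.
  exact/CR/(agx R (or_introl erefl) t tP)/CR.
(* The list [s2] covers the support of [R] and may contain indices beyond [be]. Its extra indices
   are dropped, since [C] reads only [s] and [be]. *)
have {Q2} : Qs (s1 ++ [:: be]) C (fun _ => m i).
  apply: Qs_weaken Q2 => // [x xs|r r' rr'].
    by apply/s2P/List.in_app_iff; right.
  rewrite /C (hs r r') => [|x xs].
    by rewrite rr' //; apply/List.in_app_iff; right; left.
  by apply: rr'; apply/List.in_app_iff; left; apply/s1P.
move=> /Qs_cat /Qs_ex [r /= /(_ (heval r h)) [a [ha]]].
rewrite /C upd_eq (hs (upd r be a) r) // => x /sbe xbe.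
by rewrite upd_neq // => e; apply: (@wo_irr _ be); rewrite -{1}e.
Qed.

Definition limit_gen (al : Lam) : limit := hclass (hgen M al).

Lemma limit_gen_cofinal : cofinal_seq limit_gen.
Proof.
split=> [al be albe|b].
  apply/limit_lt; have : ev (fun i => heval (g i) (hgen M al) ≺ g i be).
    apply: (@gen_above (hgen M al) [:: al]) => [r r' rr'|x [<-|[]]//].
    by apply: rr'; left.
  move=> H; have H1 := val_hclass (hgen M al); have H2 := val_hclass (hgen M be).
  by apply: ev_mono (ev_and H (ev_and H1 H2)) => i [? [-> ->]].
have [s sP] := heval_finsupp (sval b); have [be sbe] := regular_above Lamreg s.
exists be => /limit_lt H; have H1 := val_hclass (hgen M be).
have [i [[h1 h2] h3]] := ev_ex (ev_and (ev_and H H1) (gen_above sP sbe)).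
by move: h1; rewrite h2 /=; apply: (lt_nlt lt_irr lt_trans).
Qed.

Lemma limit_card : (exists f : Func L -> nat, injective f) ->
  card_le Lam K -> equinumerous limit M.
Proof.
move=> cL LamK.
have KM : card_le K M.
  exists m => i j e; case: (wo_total i j) => [/m_incr|[//|/m_incr]]; rewrite e => /lt_irr //.
apply: Cantor_Bernstein.
  apply: card_le_trans (hull_card_le _ (card_le_trans LamK KM) cL).
    by exists sval => x y; rewrite -{2}[x]hclass_val -{2}[y]hclass_val => ->.
  exact: card_le_trans Kreg.2.1 KM.
exists limit_embed => a b /hclassE /ev_ex [i] //.
Qed.

End Limit.

(** * Cofinality and the conclusion *)

Lemma cofinal_seq_cof_eq (L : Lang) (N : Structure L) (Lam : WellOrder) (f : Lam -> N) :
  (forall a b c : N, ltM a b -> ltM b c -> ltM a c) ->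
  (forall a b : N, ltM a b \/ a = b \/ ltM b a) ->
  regular_cardinal Lam -> cofinal_seq f -> cof_eq N Lam.
Proof.
move=> tr tot Lamreg [finc fcof]; split; first by exists f.
move=> K' _ K'Lam [g [ginc gcof]].
(* The sequence [f] catches up with [g x] at the index [a x]. By regularity of [Lam] these indices
   are bounded, and hence so is [g]. *)
have [a aP] := choice (fun x => fcof (g x)).
have [al alP] := regular_bounded Lamreg a K'Lam.
have [x xP] := gcof (f al); apply: xP.
exact: nlt_lt_trans tr tot _ _ _ (aP x) (finc _ _ (alP x)).
Qed.

(** A strictly increasing cofinal map of [Lam] into [K] suffices. It is built by recursion, staying
    at or above the bijection [b] and above all earlier values; these are bounded, as initial
    segments of [Lam] have fewer than [K] elements. *)
Lemma cofinal_seq_transfer (L : Lang) (N : Structure L) (K Lam : WellOrder) (f : K -> N) :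
  (forall a b c : N, ltM a b -> ltM b c -> ltM a c) ->
  (forall a b : N, ltM a b \/ a = b \/ ltM b a) ->
  regular_cardinal K -> regular_cardinal Lam -> equinumerous Lam K ->
  cofinal_seq f -> exists f' : Lam -> N, cofinal_seq f'.
Proof.
move=> tr tot Kreg Lamreg [b [b' bb' b'b]] [finc fcof].
have [|i g g' x gg' [h1 h2]|i g _|g gP] := @wf_choice Lam (@wo_lt Lam) K
    (projT1 (cid Kreg.2.1) 0)
    (fun al g x => ~ wo_lt x (b al) /\ forall be, wo_lt be al -> wo_lt (g be) x).
- exact: wo_wf.
- by split=> // be bei; rewrite -gg' //; apply: h2.
- have [|y yP] := @regular_bounded K Kreg {be | wo_lt be i} (fun p => g (sval p)).
    have [le nle] := cardinal_seg_lt Lamreg i.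
    split; first by apply: card_le_trans le _; exists b; apply: can_inj bb'.
    move=> le'; apply: nle; apply: card_le_trans le'.
    by exists b; apply: can_inj bb'.
  have [z zP] := regular_above Kreg [:: b i; y]; exists z; split.
    move=> zb; apply: (wo_irr (wo_trans zb _)); apply: zP; left => //.
  move=> be bei; apply: wo_trans (yP (exist _ be bei)) (zP y _).
  by right; left.
exists (fun al => f (g al)); split=> [al be /((gP be).2 al) /finc //|x].
have [i ix] := fcof x; exists (b' i) => h.
have [h1 _] := gP (b' i); rewrite b'b in h1.
apply: ix; case: (wo_nltNgt h1) => [<-//|/finc h2]; exact: tr h2 h.
Qed.

Theorem theorem1p3 :
  forall (L : Lang) (T : theory L),
    countable_lang L ->
    complete_theory T ->
    has_skolem_functions T ->
    lt_linear_in T ->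
    inaccessibility_scheme T ->
  forall (K : WellOrder) (M : Structure L),
    regular_cardinal K ->
    is_model T M ->
    kappa_saturated K M ->
    cof_eq M K ->
  forall Lam : WellOrder,
    regular_cardinal Lam -> card_le Lam K ->
    exists (N : Structure L) (h : M -> N),
      elem_end_ext h /\ equinumerous N M /\ cof_eq N Lam.
Proof.
move=> L T [cL _] [Tsent _] Tsk Tlin Tinacc K M Kreg MT Msat [[m [m_incr m_cof]] _]
  Lam Lamreg LamK.
have [irr [tr tot]] := Tlin M MT.
(* If [K] and [Lam] have the same cardinality, [M] itself serves, with its cofinal sequence
   reindexed. *)
have [KLam|nKLam] := pselect (card_le K Lam).
  have [f fcof] := cofinal_seq_transfer tr tot Kreg Lamreg (Cantor_Bernstein LamK KLam)
    (conj m_incr m_cof).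
  exists M, id; split; first by split=> // b a _; exists b.
  split; first by exists id, id.
  exact: cofinal_seq_cof_eq fcof.
have scheme n k phi fv z0 := Tinacc n k phi fv M MT z0.
have skolem theta : exists tau : term L, forall e : nat -> M,
  (exists a : M, sat (scons a e) theta) -> sat (scons (eval e tau) e) theta.
  by have [tau tauP] := Tsk theta; exists tau; apply: tauP.
have [g gP] := tower_exists irr tr tot scheme Kreg Lamreg.2.1 (conj LamK nKLam) Msat m_incr.
have coh i j R : wo_lt j i -> definable (@none _ M) R -> agree R (m j) (g i) (g j).
  by move=> ji dR; apply: (gP i).1.
have lrg i : large (m i) (g i) := (gP i).2.
pose N := limit (M := M) (Lam := Lam) Kreg g.
pose h : M -> N := limit_embed Kreg g.
have hel : elementary_embedding h.
  exact: limit_embed_elementary.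
(* The truth of a sentence does not depend on the environment, so elementarity of [h] carries [T] to
   [N]. The order of [N] is then linear because [T] says so. *)
have NT : is_model T N.
  move=> p Tp e; have := MT p Tp (fun _ => inh M); rewrite hel.
  by rewrite (sat_fv (e' := e) (Tsent p Tp)).
have [_ [Ntr Ntot]] := Tlin N NT.
exists N, h; split; first by split=> // b a; apply: (limit_end irr tr tot m_incr m_cof coh).
split; first exact: (limit_card irr Kreg g m_incr cL LamK).
apply: cofinal_seq_cof_eq => //.
exact: (limit_gen_cofinal irr tr tot Kreg Lamreg m_incr m_cof coh lrg).
Qed.
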